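(* Let $X$ and $Y$ be homogeneous Hilbertian operator spaces and assume that $X$ is infinite dimensional. If $X$ completely isomorphically embeds into $c_0(Y)$, then $X$ completely isomorphically embeds into $Y$. In particular, if (under these assumptions) $X$ and $Y$ have the same density character, then $X$ and $Y$ are completely isomorphic.
   Context: An operator space $X$ is Hilbertian if it is isomorphic, as a Banach space, to a Hilbert space (of arbitrary density character). For $\lambda\ge 1$, $X$ is $\lambda$-homogeneous if every bounded linear operator $u\colon X\to X$ satisfies $\|u\|_{\mathrm{cb}}\le \lambda\|u\|$; $X$ is homogeneous if it is $\lambda$-homogeneous for some $\lambda\ge 1$. A complete isomorphic embedding is a completely bounded injective linear map whose inverse, defined on its image, is completely bounded. $c_0(Y)$ is the space of sequences $(y_n)_{n\in\mathbb{N}}$ in $Y$ with $\|y_n\|\to 0$, with operator space structure $\|[x_{ij}]\|_{\mathrm{M}_k(c_0(Y))}=\sup_n\|[x_{ij}(n)]\|_{\mathrm{M}_k(Y)}$. *)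

(* Defs.v *)
From HB Require Import structures.
From mathcomp Require Import all_boot all_order all_algebra.
From mathcomp Require Import all_classical all_reals all_analysis.
From mathcomp Require Import sesquilinear complex.
Set Implicit Arguments.
Unset Strict Implicit.
Unset Printing Implicit Defensive.
Import Order.TTheory GRing.Theory Num.Theory numFieldNormedType.Exports.
Local Open Scope classical_set_scope.
Local Open Scope card_scope.
Local Open Scope ring_scope.

(* The norm of a normed module over [R[i]] takes its values in [R[i]]; it is   *)
(* a nonnegative real there, and [rnorm] is its value in [R].                 *)
Definition rnorm (R : realType) (V : normedModType R[i]) (x : V) : R :=
  complex.Re `|x|.

Section rnorm_lemmas.
Context (R : realType) (V : normedModType R[i]).
Implicit Types x y : V.

Lemma rnormE x : (rnorm x)%:C%C = `|x|.
Proof.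
rewrite /rnorm; have := normr_ge0 x.
by case: (`|x|) => a b; rewrite lecE /= => /andP[/eqP -> _].
Qed.

Lemma rnorm_ge0 x : 0 <= rnorm x.
Proof. by rewrite -lecR rnormE normr_ge0. Qed.

Lemma rnorm0 : rnorm (0 : V) = 0.
Proof. by rewrite /rnorm normr0. Qed.

Lemma rnormD x y : rnorm (x + y) <= rnorm x + rnorm y.
Proof. by rewrite -lecR rmorphD /= !rnormE ler_normD. Qed.

Lemma rnormZ (a : R[i]) x : rnorm (a *: x) = complex.Re `|a| * rnorm x.
Proof.
rewrite /rnorm normrZ -(rnormE x); case: (`|a|) => p q /=.
by rewrite mulr0 subr0.
Qed.

End rnorm_lemmas.

(* The norm of the Banach space [H] comes from a complex inner product. *)
Definition is_hilbert (R : realType) (H : completeNormedModType R[i]) : Prop :=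
  exists dot : {dot H for (Num.conj : R[i] -> R[i])},
    forall x : H, `|x| ^+ 2 = dot x x.

(* The norm on [l_2^n(H)] and the norm in [M_n(B(H)) = B(l_2^n(H))] of a       *)
(* matrix of operators on [H] (infinite when the matrix is unbounded).        *)
Definition l2norm (R : realType) (H : normedModType R[i]) n (h : 'cV[H]_n) : R :=
  Num.sqrt (\sum_(i < n) rnorm (h i 0) ^+ 2).

Definition opmxnorm (R : realType) (H : normedModType R[i]) n
    (T : 'I_n -> 'I_n -> H -> H) : \bar R :=
  ereal_sup [set (l2norm (\col_i \sum_(j < n) T i j (h j 0)))%:E
            | h in [set h : 'cV[H]_n | l2norm h <= 1]].

HB.mixin Record hasMatrixNorm (R : realType) X & GRing.Lmodule R[i] X := {
  mnorm : forall n, 'M[X]_n -> R }.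

#[short(type="matrixNormedType")]
HB.structure Definition MatrixNormed (R : realType) :=
  {X of GRing.Lmodule R[i] X & hasMatrixNorm R X}.

Arguments mnorm {R s n} x.

(* An operator space is a closed linear subspace of some [B(H)], known here    *)
(* through a linear complete isometry [J] onto it.  Each [J x] is bounded,     *)
(* since [opmxnorm] is finite for [n = 1], and the image is closed, since     *)
(* [X] is complete.                                                           *)
HB.mixin Record isOperatorSpace (R : realType) X
    & CompleteNormedModule R[i] X & hasMatrixNorm R X := {
  mnorm1 : forall x : X, mnorm (const_mx x : 'M[X]_1) = rnorm x;
  mnorm_concrete :
    exists (H : completeNormedModType R[i]) (J : X -> H -> H),
      [/\ is_hilbert H,
          forall x, linear (J x),
          forall h, linear (J^~ h) &
          forall n (x : 'M[X]_n),
            (mnorm x)%:E = opmxnorm (fun i j => J (x i j))] }.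

#[short(type="opSpaceType")]
HB.structure Definition OperatorSpace (R : realType) :=
  {X of CompleteNormedModule R[i] X & hasMatrixNorm R X & isOperatorSpace R X}.

Section bounded_maps.
Context (R : realType).
Local Open Scope ereal_scope.

Definition opnorm (V W : normedModType R[i]) (u : V -> W) : \bar R :=
  ereal_sup [set (rnorm (u x))%:E | x in [set x : V | (rnorm x <= 1)%R]].

(* The completely bounded norm of the restriction to the subspace [A] of [X]   *)
(* of the map [u]; [M_n(A)] carries the norm of [M_n(X)].                     *)
Definition cbnorm_on (X Y : matrixNormedType R) (A : set X) (u : X -> Y) :
    \bar R :=
  ereal_sup [set r | exists n (x : 'M[X]_n),
    [/\ forall i j, A (x i j), (mnorm x <= 1)%R & r = (mnorm (map_mx u x))%:E]].

Definition cbnorm (X Y : matrixNormedType R) (u : X -> Y) : \bar R :=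
  cbnorm_on setT u.

Definition complete_embedding (X Y : matrixNormedType R) (u : {linear X -> Y}) :
    Prop :=
  [/\ injective u, cbnorm u < +oo &
      exists v : Y -> X, cancel u v /\ cbnorm_on (range u) v < +oo].

Definition completely_embeds (X Y : matrixNormedType R) : Prop :=
  exists u : {linear X -> Y}, complete_embedding u.

Definition completely_isomorphic (X Y : matrixNormedType R) : Prop :=
  exists u : {linear X -> Y}, complete_embedding u /\ range u = setT.

Definition homogeneous_with (X : opSpaceType R) (lambda : R) : Prop :=
  forall u : {linear X -> X},
    opnorm u < +oo -> cbnorm u <= lambda%:E * opnorm u.

Definition homogeneous (X : opSpaceType R) : Prop :=
  exists2 lambda : R, (1 <= lambda)%R & homogeneous_with X lambda.

Definition hilbertian (X : completeNormedModType R[i]) : Prop :=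
  exists (H : completeNormedModType R[i])
         (u : {linear X -> H}) (v : {linear H -> X}),
    [/\ is_hilbert H, cancel u v, cancel v u, continuous u & continuous v].

Definition finite_dimensional (X : lmodType R[i]) : Prop :=
  exists n (e : 'I_n -> X),
    forall x, exists c : 'I_n -> R[i], x = (\sum_(i < n) c i *: e i)%R.

End bounded_maps.

(* The cardinality of [D] is the density character of [T]. *)
Definition density_set (T : topologicalType) (D : set T) : Prop :=
  dense D /\ forall E : set T, dense E -> D #<= E.

Definition same_density (T U : topologicalType) : Prop :=
  exists (D : set T) (E : set U), [/\ density_set D, density_set E & D #= E].

Section c0_space.
Context (R : realType) (Y : opSpaceType R).

Definition null_seq : {pred nat -> Y} :=
  [pred y : nat -> Y | `[< rnorm (y n) @[n --> \oo] --> (0 : R) >]].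

Lemma null_seq_submod_closed : submod_closed null_seq.
Proof.
split.
  apply/asboolP => /=.
  have -> : (fun n => rnorm ((0 : nat -> Y) n)) = cst 0.
    by apply/funext => n; rewrite rnorm0.
  exact: cvg_cst.
move=> a x y /asboolP x0 /asboolP y0; apply/asboolP => /=.
apply: (@squeeze_cvgr _ _ _ _ (fun=> 0)
  (fun n => complex.Re `|a| * rnorm (x n) + rnorm (y n))).
- near=> n; rewrite rnorm_ge0 /=.
  by apply: le_trans (rnormD _ _) _; rewrite rnormZ.
- exact: cvg_cst.
- rewrite -[X in _ --> X]addr0 -[X in _ --> X + _](mulr0 (complex.Re `|a|)).
  by apply: cvgD y0; apply: cvgMl_tmp x0.
Unshelve. all: by end_near. Qed.

HB.instance Definition _ :=
  GRing.isSubmodClosed.Build R[i] (nat -> Y) null_seq null_seq_submod_closed.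

Record c0 : Type := C0 { c0_seq :> nat -> Y ; _ : c0_seq \in null_seq }.

HB.instance Definition _ := [isSub for c0_seq].
HB.instance Definition _ := [Choice of c0 by <:].
HB.instance Definition _ := [SubChoice_isSubLmodule of c0 by <:].

(* The supremum is over a bounded set: the norm in [M_n(Y)] of a matrix is at  *)
(* most the sum of the norms of its entries.                                  *)
Definition c0_mnorm n (x : 'M[c0]_n) : R :=
  sup (range (fun k : nat => mnorm (\matrix_(i, j) (x i j : nat -> Y) k))).

HB.instance Definition _ := hasMatrixNorm.Build R c0 c0_mnorm.

End c0_space.

(* Main.v *)
(* Transport X and Y to Hilbert spaces H and K, and let T_n : H -> K correspond
   to the coordinates U_n : X -> Y of the embedding of X into c_0(Y).  If every
   T_n were arbitrarily small on suitable subspaces of finite codimension, a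
   gliding hump would produce a sum y of m orthonormal vectors with (T_n y)_n
   bounded independently of m, contradicting |y| = sqrt m.  So some T_n carries arbitrarily many
   orthonormal vectors b_i to orthogonal vectors bounded below by a fixed c.

   Let V : X -> Y be any isomorphic embedding of the underlying Hilbert spaces,
   with bounded left inverse P.  Since each U_n P is completely bounded on Y by
   homogeneity, |U_n x| <= M |V x| for all n, so V^-1 is completely bounded.  In
   the other direction, on any finite-dimensional subspace V factors through a
   rotation of X to the span of the b_i, followed by U_n and a map of Y of norm
   at most M / c, so that the homogeneity of X and Y bounds V completely.

   The map V exists by counting: an orthonormal basis of H injects into the
   finite sequences over a dense subset of K of the size of a basis of K.  When
   the density characters agree, the bases are equipotent and V can be taken
   onto. *)

Require Import Defs.
From HB Require Import structures.
From mathcomp Require Import all_boot all_order all_algebra.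
From mathcomp Require Import all_classical all_reals all_analysis.
From mathcomp Require Import sesquilinear complex.
From mathcomp Require Import lra ring.
Set Implicit Arguments.
Unset Strict Implicit.
Unset Printing Implicit Defensive.
Import Order.TTheory GRing.Theory Num.Theory numFieldNormedType.Exports.
Local Open Scope classical_set_scope.
Local Open Scope card_scope.
Local Open Scope ring_scope.

(** * Finite sequences over an infinite type *)

Lemma injective_total (T U : Type) :
  (exists f : T -> U, injective f) \/ (exists g : U -> T, injective g).
Proof.
pose P := [set G : set (T * U) |
  (forall x y y', G (x, y) -> G (x, y') -> y = y') /\
  (forall x x' y, G (x, y) -> G (x', y) -> x = x')].
have [|G [[Gf Gi] Gmax]] := @Zorn_bigcup _ P.
  move=> F FP Ftot; split=> [x y y'|x x' y] [A FA Axy] [B FB Bxy].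
    by have [/(_ _ Axy)|/(_ _ Bxy)] := Ftot _ _ FA FB => H;
      [apply: (FP _ FB).1 H Bxy|apply: (FP _ FA).1 Axy H].
  by have [/(_ _ Axy)|/(_ _ Bxy)] := Ftot _ _ FA FB => H;
    [apply: (FP _ FB).2 H Bxy|apply: (FP _ FA).2 Axy H].
have [Gdom|/existsNP[x0 /forallNP nx0]] := pselect (forall x, exists y, G (x, y)).
  have [f fG] := choice Gdom; left; exists f => x x' ff.
  by have := fG x; rewrite ff => /Gi; apply; apply: fG.
right; have [Gran|/existsNP[y0 /forallNP ny0]] :=
    pselect (forall y, exists x, G (x, y)).
  have [g gG] := choice Gran; exists g => y y' gg.
  by have := gG y; rewrite gg => /Gf; apply; apply: gG.
exfalso; apply: (Gmax (G `|` [set (x0, y0)])).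
  split; first exact: subsetUl.
  by move=> /(_ (x0, y0)) /(_ (or_intror erefl)); apply: nx0.
split=> [x y y'|x x' y].
  move=> [h|[ex ey]] [h'|[ex' ey']].
  - exact: Gf h h'.
  - by case: (nx0 y); rewrite -ex'.
  - by case: (nx0 y'); rewrite -ex.
  - by rewrite ey ey'.
move=> [h|[ex ey]] [h'|[ex' ey']].
- exact: Gi h h'.
- by case: (ny0 x); rewrite -ey'.
- by case: (ny0 x'); rewrite -ey.
- by rewrite ex ex'.
Qed.

Section seq_injection.
Variable T : choiceType.

Definition seqs (A : set T) := [set s : seq T | forall x, x \in s -> A x].

(** The function is total on [seq T] so that all codings share one type; only its values on
    sequences over [p.1] carry meaning, which is why [extends] compares it only there. *)
Definition coding (p : set T * (seq T -> T)) :=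
  [/\ p.1 !=set0, forall s, seqs p.1 s -> p.1 (p.2 s) &
      forall s t, seqs p.1 s -> seqs p.1 t -> p.2 s = p.2 t -> s = t].

Definition extends (p q : set T * (seq T -> T)) :=
  p.1 `<=` q.1 /\ forall s, seqs p.1 s -> p.2 s = q.2 s.

Lemma seqsS (A B : set T) : A `<=` B -> seqs A `<=` seqs B.
Proof. by move=> AB s sA x /sA/AB. Qed.

(** The starting point for Zorn: an infinite type contains a copy of the naturals, and finite
    sequences of naturals are countable. *)
Lemma coding_countable : infinite_set [set: T] -> exists p, coding p.
Proof.
move=> /infiniteP /card_leP[f].
pose i n : T := val (f (SigSub (mem_set (I : setT n)))).
have i_inj : injective i.
  move=> m n /val_inj /(inj _) fmn.
  by have /(congr1 val) := fmn (mem_set I) (mem_set I).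
pose j x := xget 0%N [set n | i n = x].
have ij n : j (i n) = n.
  by rewrite /j; case: xgetP => [m _ /i_inj //|/(_ n) []].
have map_ij s : seqs (range i) s -> map i (map j s) = s.
  elim: s => //= x s IH xs; rewrite IH => [|y ys]; last first.
    by apply: xs; rewrite inE ys orbT.
  by have [|n _ <-] := xs x; rewrite ?mem_head// ij.
exists (range i, fun s => i (pickle (map j s))); split=> /=.
- by exists (i 0%N), 0%N.
- by move=> s _; exists (pickle (map j s)).
- move=> s t si ti /i_inj /(pcan_inj pickleK) st.
  by rewrite -(map_ij s) // st map_ij.
Qed.

(** A finite sequence over the union of a chain already lies over one member of it, so the codings
    glue together. *)
Lemma coding_chain (F : set (set T * (seq T -> T))) : F !=set0 -> F `<=` coding ->
  (forall p q, F p -> F q -> extends p q \/ extends q p) ->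
  exists2 p, coding p & forall q, F q -> extends q p.
Proof.
move=> [p0 Fp0] Fcod Ftot.
pose A := \bigcup_(p in F) p.1.
(* Any member of the chain that contains the letters of [s] may be chosen: members agree on [s] by
   [extends]. *)
pose g s := (xget p0 [set p | F p /\ seqs p.1 s]).2 s.
have seqsA s t : seqs A s -> seqs A t -> exists p, [/\ F p, seqs p.1 s & seqs p.1 t].
  move=> sA tA.
  have {sA tA} : seqs A (s ++ t).
    by move=> x; rewrite mem_cat => /orP[/sA|/tA].
  move=> stA; suff [p Fp pst] : exists2 p, F p & seqs p.1 (s ++ t).
    by exists p; split=> // x xs; apply: pst; rewrite mem_cat xs ?orbT.
  elim: (s ++ t) stA => [|x u IH] xuA; first by exists p0.
  have [|q Fq qu] := IH; first by move=> y yu; apply: xuA; rewrite inE yu orbT.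
  have [r Fr rx] := xuA x (mem_head _ _).
  have [[qr _]|[rq _]] := Ftot _ _ Fq Fr.
    by exists r => // y; rewrite inE => /orP[/eqP ->//|/qu/qr].
  by exists q => // y; rewrite inE => /orP[/eqP ->|/qu//]; apply: rq.
have gE p s : F p -> seqs p.1 s -> g s = p.2 s.
  move=> Fp ps; rewrite /g; case: xgetP => [q -> [Fq qs]|/(_ p) []//].
  by have [[_ ->]|[_ ->]] := Ftot _ _ Fp Fq.
exists (A, g); last first.
  by move=> q Fq; split=> [x qx|s qs /=]; [exists q|rewrite (gE q)].
split=> /= [|s sA|s t sA tA].
- by have [[x px] _ _] := Fcod _ Fp0; exists x, p0.
- have [p [Fp ps _]] := seqsA _ _ sA sA; exists p => //; rewrite (gE p) //.
  by have [_ pA _] := Fcod _ Fp; apply: pA.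
- have [p [Fp ps pt]] := seqsA _ _ sA tA; rewrite !(gE p) //.
  by have [_ _ pinj] := Fcod _ Fp; apply: pinj.
Qed.

(** Each letter is named by a word [enc x] over [p.1], the words are coded, and the word of their
    codes is coded once more. *)
Definition recode (p : set T * (seq T -> T)) (enc : T -> seq T) s :=
  p.2 (map (p.2 \o enc) s).

Lemma recode_inj p (C : set T) (enc : T -> seq T) : coding p ->
  (forall x, C x -> seqs p.1 (enc x)) ->
  (forall x y, C x -> C y -> enc x = enc y -> x = y) ->
  (forall s, seqs C s -> p.1 (recode p enc s)) /\
  (forall s t, seqs C s -> seqs C t -> recode p enc s = recode p enc t -> s = t).
Proof.
move=> [_ pA pinj] encA encI; rewrite /recode.
have in_seqs s : seqs C s -> seqs p.1 (map (p.2 \o enc) s).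
  by move=> sC _ /mapP[x /sC Cx ->]; apply/pA/encA.
split=> [s /in_seqs/pA//|s t sC tC /pinj].
move=> /(_ (in_seqs _ sC) (in_seqs _ tC)).
elim: s t sC tC => [|x s IH] [|y t] //= sC tC [exy /IH ->].
- congr cons; have Cx := sC x (mem_head _ _); have Cy := tC y (mem_head _ _).
  by apply: encI => //; apply: pinj exy; apply: encA.
- by move=> z zs; apply: sC; rewrite inE zs orbT.
- by move=> z zs; apply: tC; rewrite inE zs orbT.
Qed.

(* Take a maximal coding (A, g). If A injected into its complement, with image
   B, then g would extend to A `|` B; so the complement injects into A and
   finite sequences over T can be coded by finite sequences over A. *)
Lemma seq_injection : infinite_set [set: T] ->
  exists f : seq T -> T, injective f.
Proof.
move=> /coding_countable[p0 cod0].
pose R (p q : {p | coding p}) := `[< extends (sval p) (sval q) >].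
have [|||[[A g] cod] pmax] := @ZL_preorder {p | coding p} (exist _ p0 cod0) R.
- by move=> p; apply/asboolP; split.
- move=> q p r /asboolP[pq pq'] /asboolP[qr qr']; apply/asboolP; split.
    exact: subset_trans pq qr.
  by move=> s sp; rewrite pq' // qr' //; apply: seqsS sp.
- move=> F Ftot; have [->|/set0P[p Fp]] := eqVneq F set0.
    by exists (exist _ p0 cod0).
  have [|_ [q _ <-]|_ _ [q Fq <-] [r Fr <-]|q codq qub] :=
      @coding_chain [set sval p | p in F].
  + by exists (sval p), p.
  + exact: svalP.
  + by have [/asboolP|/asboolP] := Ftot _ _ Fq Fr; [left|right].
  + by exists (exist _ q codq) => s Fs; apply/asboolP/qub; exists s.
have [gA0 gA ginj] := cod; rewrite /= in gA0 gA ginj.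
have [[f f_inj]|[f f_inj]] := injective_total A (~` A : set T).
- pose h x : T := match pselect (A x) with
    | left Ax => val (f (SigSub (mem_set Ax))) | right _ => x end.
  have hA x : A x -> ~ A (h x).
    by move=> Ax; rewrite /h; case: pselect => // Ax'; exact: (set_mem (valP (f _))).
  have h_inj x y : A x -> A y -> h x = h y -> x = y.
    move=> Ax Ay; rewrite /h; case: pselect => // Ax'; case: pselect => // Ay'.
    by move=> /val_inj /f_inj /(congr1 val).
  pose B := h @` A.
  (* A point of [A] is named by a single letter and a point of [B] by its preimage doubled, so the
     lengths keep the two kinds apart. *)
  pose enc x : seq T := if x \in A then [:: x] else
     let a := xget x [set a | A a /\ h a = x] in [:: a; a].
  have encP x : B x -> exists2 a, enc x = [:: a; a] & A a /\ h a = x.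
    move=> [a Aa <-]; rewrite /enc memNset; last exact: hA.
    by case: xgetP => [b _ hb|/(_ a) []//]; exists b.
  have [||codeA codeI] := @recode_inj _ (A `|` B) enc cod.
  + move=> x [Ax|/encP[a -> [Aa _]]] y.
      by rewrite /enc mem_set // inE => /eqP ->.
    by rewrite !inE orbb => /eqP ->.
  + have encAE x : A x -> enc x = [:: x] by move=> Ax; rewrite /enc mem_set.
    move=> x y [Ax|/encP[a -> [_ <-]]] [Ay|/encP[b -> [_ <-]]].
    * by rewrite !encAE // => -[].
    * by rewrite !encAE.
    * by rewrite !encAE.
    * by case=> ->.
  set code := recode _ _ in codeA codeI.
  (* Sequences that leave [A] receive codes in [B], away from the values of [g], so injectivity
     survives the extension. *)
  pose g' s := if `[< seqs A s >] then g s else h (code s).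
  have g'E s : seqs A s -> g' s = g s by move=> As; rewrite /g' asboolT.
  have g'N s : ~ seqs A s -> g' s = h (code s) by move=> As; rewrite /g' asboolF.
  have cod' : coding (A `|` B, g').
    split=> /= [|s sAB|s t sAB tAB].
    + by have [a Aa] := gA0; exists a; left.
    + have [sA|sA] := pselect (seqs A s); first by rewrite g'E //; left; apply: gA.
      by rewrite g'N //; right; exists (code s) => //; apply: codeA.
    + have [sA|sA] := pselect (seqs A s); have [tA|tA] := pselect (seqs A t).
      * by rewrite !g'E //; apply: ginj.
      * rewrite g'E // g'N // => e; case: (hA (code t)); first exact: codeA.
        by rewrite -e; apply: gA.
      * rewrite g'N // g'E // => e; case: (hA (code s)); first exact: codeA.
        by rewrite e; apply: gA.
      * rewrite !g'N // => /h_inj e; apply: codeI => //.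
        by apply: e; apply: codeA.
  (* Maximality puts the nonempty set [B] inside [A], although [h] maps [A] off [A]. *)
  have /asboolP[/= BA _] : R (exist _ _ cod') (exist _ _ cod).
    apply: pmax; apply/asboolP; split=> /= [|s sA]; first exact: subsetUl.
    by rewrite g'E.
  have [a Aa] := gA0; case: (hA a) => //; apply: BA; right; by exists a.
- pose h x : T := match pselect ((~` A) x) with
    | left Ax => val (f (SigSub (mem_set Ax))) | right _ => x end.
  (* Now [h] injects the complement into [A], so doubled letters name the points off [A] and every
     point of [T] gets a word over [A]. *)
  pose enc x := if x \in A then [:: x] else [:: h x; h x].
  have [||_ codeI] := @recode_inj _ setT enc cod.
  + move=> x _ y; rewrite /enc; case: ifPn => [/set_mem Ax|/negP xA].
      by rewrite inE => /eqP ->.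
    rewrite !inE orbb => /eqP ->; rewrite /h; case: pselect => [nAx|].
      exact: (set_mem (valP (f _))).
    by move=> /contrapT /mem_set.
  + move=> x y _ _; rewrite /enc.
    case: ifPn => [_|/negP xA]; case: ifPn => [_|/negP yA] //; first by case.
    case=> _; rewrite /h; case: pselect => [nAx|/contrapT/mem_set//].
    case: pselect => [nAy|/contrapT/mem_set//].
    by move=> /val_inj /f_inj /(congr1 val).
  by eexists => s t; apply: codeI.
Qed.

End seq_injection.

(** * Hilbert spaces *)

Section normed_spaces.
Context (R : realType).
Implicit Types V W : normedModType R[i].

Lemma rnormN V (x : V) : rnorm (- x) = rnorm x.
Proof. by rewrite /rnorm normrN. Qed.

Lemma rnormB V (x y : V) : rnorm (x - y) = rnorm (y - x).
Proof. by rewrite -rnormN opprB. Qed.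

Lemma rnorm_eq0 V (x : V) : rnorm x = 0 -> x = 0.
Proof. by move=> x0; apply/normr0_eq0; rewrite -rnormE x0. Qed.

Lemma rnorm_gt0 V (x : V) : x != 0 -> 0 < rnorm x.
Proof.
move=> x0; rewrite lt_neqAle rnorm_ge0 andbT eq_sym.
by apply: contra_neq x0 => /rnorm_eq0.
Qed.

Lemma rnorm_triangle V (x y z : V) : rnorm (x - z) <= rnorm (x - y) + rnorm (y - z).
Proof. by rewrite (le_trans _ (rnormD _ _))// addrA subrK. Qed.

Lemma rnormZR V (a : R) (x : V) : rnorm (a%:C%C *: x) = `|a| * rnorm x.
Proof. by rewrite rnormZ normc_def /= expr0n addr0 sqrtr_sqr. Qed.

Lemma rnorm_sum V (I : Type) (s : seq I) (F : I -> V) :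
  rnorm (\sum_(i <- s) F i) <= \sum_(i <- s) rnorm (F i).
Proof.
elim: s => [|i s IH]; first by rewrite !big_nil rnorm0.
by rewrite !big_cons (le_trans (rnormD _ _))// lerD2l.
Qed.

Definition bounded_by V W (u : V -> W) (M : R) :=
  forall x, rnorm (u x) <= M * rnorm x.

Lemma bounded_by_ge0 V W (u : V -> W) (M : R) :
  bounded_by u M -> bounded_by u `|M|.
Proof.
move=> uM x; apply: le_trans (uM x) _.
by rewrite ler_wpM2r ?rnorm_ge0 ?ler_norm.
Qed.

Lemma bounded_by_comp V W (U : normedModType R[i]) (u : V -> W) (v : W -> U)
  (M N : R) : 0 <= N -> bounded_by u M -> bounded_by v N ->
  bounded_by (v \o u) (N * M).
Proof.
move=> N0 uM vN x /=; apply: le_trans (vN _) _.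
by rewrite -mulrA ler_wpM2l.
Qed.

Lemma continuous_bounded_by V W (u : {linear V -> W}) :
  continuous u -> exists2 M : R, 0 <= M & bounded_by u M.
Proof.
move=> /linear_bounded_continuous /linear_boundedP /pinfty_ex_gt0[M M0 uM].
exists (complex.Re M) => [|x].
  by move: M0; rewrite ltcE => /andP[_ /ltW].
have -> : complex.Re M = complex.Re `|M| by rewrite gtr0_norm.
by rewrite -rnormZ -lecR !rnormE normrZ gtr0_norm.
Qed.

Lemma opnorm_bounded_by V W (u : V -> W) (M : R) :
  0 <= M -> bounded_by u M -> (opnorm u <= M%:E)%E.
Proof.
move=> M0 uM; apply: ge_ereal_sup => _ [x x1 <-]; rewrite lee_fin.
by apply: le_trans (uM x) _; rewrite ler_piMr.
Qed.

Lemma cauchy_rnorm (V : completeNormedModType R[i]) (b : nat -> V) :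
  (forall e : R, 0 < e -> exists N, forall m n,
     (N <= m)%N -> (N <= n)%N -> rnorm (b m - b n) < e) ->
  exists l, forall e : R, 0 < e -> exists N, forall n, (N <= n)%N -> rnorm (b n - l) < e.
Proof.
move=> bC.
have C0 (e : R[i]) : 0 < e -> e = (complex.Re e)%:C%C /\ 0 < complex.Re e.
  by case: e => a c; rewrite ltcE /= => /andP[/eqP -> a0].
have /cvgrPdist_lt bl : cvg (b @ \oo).
  apply/cauchy_cvgP/cauchy_ballP => e /C0[-> e0]; near_simpl.
  have [N bN] := bC _ e0.
  exists ([set n | (N <= n)%N], [set n | (N <= n)%N]) => /=.
    by split; exists N.
  move=> [m n] [/= Nm Nn]; rewrite -ball_normE /=.
  by rewrite -rnormE ltcR; apply: bN.
exists (lim (b @ \oo)) => e e0.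
have [|N _ bN] := bl e%:C%C; first by rewrite ltcR.
by exists N => n Nn; have := bN n Nn; rewrite /= -rnormE ltcR rnormB.
Qed.

Lemma dense_rnorm V (D : set V) : dense D <->
  forall x (e : R), 0 < e -> exists2 y, D y & rnorm (x - y) < e.
Proof.
split=> [Dd x e e0|Dd O [x Ox] Oo].
  have := Dd (ball x e%:C%C).
  have [||y []] := Dd (interior (ball x e%:C%C)).
  - exists x; apply: nbhs_singleton; apply: nbhs_interior.
    by apply: nbhsx_ballx; rewrite ltcR.
  - exact: open_interior.
  - move=> /interior_subset; rewrite -ball_normE /= -rnormE ltcR => xy Dy.
    by exists y.
have /nbhs_ballP[e /= e0 eO] : nbhs x O by apply: open_nbhs_nbhs; split.
have [|y Dy xy] := Dd x (complex.Re e).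
  by move: e0; rewrite ltcE => /andP[].
exists y; split=> //; apply: eO; rewrite -ball_normE /=.
move: xy e0; rewrite -ltcR rnormE => /lt_le_trans xy; rewrite ltcE => /andP[/eqP ei _].
by apply: xy; rewrite lecE /= ei /= eqxx /=.
Qed.

End normed_spaces.

Section complex_modulus.
Context (R : realType).
Implicit Types a b : R[i].

Definition cabs a : R := complex.Re `|a|.

Lemma cabsE a : (cabs a)%:C%C = `|a|.
Proof. by rewrite /cabs RRe_real ?normr_real. Qed.

Lemma cabs_ge0 a : 0 <= cabs a.
Proof. by rewrite -lecR cabsE normr_ge0. Qed.

Lemma cabsM a b : cabs (a * b) = cabs a * cabs b.
Proof. by apply: complexI; rewrite rmorphM /= !cabsE normrM. Qed.

Lemma cabs_eq0 a : cabs a = 0 -> a = 0.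
Proof. by move=> a0; apply: normr0_eq0; rewrite -cabsE a0. Qed.

Lemma cabsR (x : R) : cabs x%:C%C = `|x|.
Proof. by rewrite /cabs normc_def /= expr0n addr0 sqrtr_sqr. Qed.

Lemma rnormZc (V : normedModType R[i]) a (x : V) : rnorm (a *: x) = cabs a * rnorm x.
Proof. exact: rnormZ. Qed.

Lemma mul_conj_cabs a : Num.conj a * a = (cabs a ^+ 2)%:C%C.
Proof. by rewrite rmorphXn /= cabsE normCK mulrC. Qed.

Lemma conjR (t : R) : Num.conj t%:C%C = t%:C%C :> R[i].
Proof. by apply: conj_Creal; apply/complex_realP; exists t. Qed.

Lemma mul_conj_scaled (t : R) a : Num.conj (t%:C%C * a) * a = (t * cabs a ^+ 2)%:C%C.
Proof. by rewrite rmorphM /= conjR -mulrA mul_conj_cabs -rmorphM. Qed.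

End complex_modulus.

(** * Inner products and orthogonal projection *)

Section inner_product.
Context (R : realType) (H : completeNormedModType R[i]).
Context (dot : {dot H for (Num.conj : R[i] -> R[i])}).
Context (dotE : forall x : H, `|x| ^+ 2 = dot x x).
Implicit Types (x y : H) (a : R[i]).

Lemma dotC x y : dot y x = Num.conj (dot x y).
Proof. by rewrite hermC expr0 mul1r. Qed.

Lemma dotDl x y z : dot (x + y) z = dot x z + dot y z.
Proof. exact: linearDl. Qed.

Lemma dotDr x y z : dot z (x + y) = dot z x + dot z y.
Proof. exact: linearDr. Qed.

Lemma dotNl x z : dot (- x) z = - dot x z.
Proof. exact: linearNl. Qed.

Lemma dotNr x z : dot z (- x) = - dot z x.
Proof. exact: linearNr. Qed.

Lemma dotZl a x z : dot (a *: x) z = a * dot x z.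
Proof. exact: linearZl_LR. Qed.

Lemma dotZr a x z : dot z (a *: x) = Num.conj a * dot z x.
Proof. exact: linearZr_LR. Qed.

Lemma dot0l z : dot 0 z = 0.
Proof. exact: linear0l. Qed.

Lemma dot0r z : dot z 0 = 0.
Proof. exact: linear0r. Qed.

Lemma dot_suml (I : Type) (s : seq I) (F : I -> H) z :
  dot (\sum_(i <- s) F i) z = \sum_(i <- s) dot (F i) z.
Proof. by elim: s => [|i s IH]; rewrite ?big_nil ?dot0l// !big_cons dotDl IH. Qed.

Lemma dot_sumr (I : Type) (s : seq I) (F : I -> H) z :
  dot z (\sum_(i <- s) F i) = \sum_(i <- s) dot z (F i).
Proof. by elim: s => [|i s IH]; rewrite ?big_nil ?dot0r// !big_cons dotDr IH. Qed.

Lemma dot_eq0C x y : dot x y = 0 -> dot y x = 0.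
Proof. by move=> xy; rewrite dotC xy rmorph0. Qed.

Lemma dot_rnorm x : dot x x = (rnorm x ^+ 2)%:C%C.
Proof. by rewrite -dotE -rnormE rmorphXn. Qed.

Lemma rnormD_sqr x y :
  rnorm (x + y) ^+ 2 = rnorm x ^+ 2 + rnorm y ^+ 2 + complex.Re (dot x y) *+ 2.
Proof.
have sqrE z : rnorm z ^+ 2 = complex.Re (dot z z) by rewrite dot_rnorm.
rewrite !sqrE dotDl !dotDr (dotC x y); case: (dot x x) => a b.
by case: (dot y y) => c d; case: (dot x y) => e f /=; ring.
Qed.

Lemma rnormD_orth x y : dot x y = 0 ->
  rnorm (x + y) ^+ 2 = rnorm x ^+ 2 + rnorm y ^+ 2.
Proof. by move=> xy; rewrite rnormD_sqr xy mul0rn addr0. Qed.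

Lemma parallelogram x y :
  rnorm (x + y) ^+ 2 + rnorm (x - y) ^+ 2 = (rnorm x ^+ 2 + rnorm y ^+ 2) *+ 2.
Proof.
rewrite !rnormD_sqr rnormN dotNr raddfN/=.
by rewrite mulNrn; ring.
Qed.

Lemma rnorm_sum_orth (I : eqType) (s : seq I) (F : I -> H) : uniq s ->
  (forall i j, i != j -> dot (F i) (F j) = 0) ->
  rnorm (\sum_(i <- s) F i) ^+ 2 = \sum_(i <- s) rnorm (F i) ^+ 2.
Proof.
move=> + Fo; elim: s => [|i s IH]; first by rewrite !big_nil rnorm0 expr0n.
move=> /= /andP[is_ us]; rewrite !big_cons rnormD_orth ?IH//.
rewrite dot_sumr big_seq big1// => j js; apply: Fo.
by apply: contraNneq is_ => ->.
Qed.

(** Take [a = t d] with [d = dot x y]: the square norm changes by [t |d|^2 (t |y|^2 - 2)]. The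
    choice [t = 1 / (|y|^2 + 1)] makes the last factor negative, so minimality forces [d = 0]. *)
Lemma minimal_orth x y : (forall a, rnorm x <= rnorm (x - a *: y)) -> dot x y = 0.
Proof.
move=> xmin; set d := dot x y.
pose t : R := (rnorm y ^+ 2 + 1)^-1.
have y1 : 0 < rnorm y ^+ 2 + 1 by rewrite ltr_wpDl ?sqr_ge0.
have t0 : 0 < t by rewrite invr_gt0.
have : rnorm x ^+ 2 <= rnorm (x - (t%:C%C * d) *: y) ^+ 2.
  by rewrite lerXn2r ?nnegrE ?rnorm_ge0.
rewrite rnormD_sqr rnormN dotNr dotZr rnormZc -/d cabsM cabsR (gtr0_norm t0).
rewrite mul_conj_scaled raddfN /=.
set c := cabs d => h.
suff : c ^+ 2 = 0 by move/eqP; rewrite sqrf_eq0 => /eqP /cabs_eq0.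
have tE : t * (rnorm y ^+ 2 + 1) = 1 by rewrite mulVf// gt_eqF.
have ty : t * rnorm y ^+ 2 <= 1 by rewrite -tE ler_wpM2l ?(ltW t0)// lerDl.
have : 0 <= (t * c ^+ 2) * (t * rnorm y ^+ 2 - 2).
  have -> : (t * c ^+ 2) * (t * rnorm y ^+ 2 - 2) =
    (t * c * rnorm y) ^+ 2 - (t * c ^+ 2) *+ 2 by ring.
  by move: h; rewrite -addrA lerDl mulNrn.
move=> h2; apply/eqP; rewrite eq_le sqr_ge0 andbT leNgt; apply/negP => c0.
suff : (t * c ^+ 2) * (t * rnorm y ^+ 2 - 2) < 0 by rewrite ltNge h2.
by rewrite pmulr_rlt0; [lra|apply: mulr_gt0].
Qed.

(* The minimising sequence of the distance from x0 to M is Cauchy by the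
   parallelogram identity. *)
Lemma orth_nondense (M : set H) (x0 : H) (e : R) :
  M 0 -> (forall a x y, M x -> M y -> M (a *: x + y)) ->
  0 < e -> (forall y, M y -> e <= rnorm (x0 - y)) ->
  exists2 w, w != 0 & forall y, M y -> dot w y = 0.
Proof.
move=> M0 Mlin e0 far.
pose D := [set rnorm (x0 - y) | y in M].
have Dinf : has_inf D.
  split; first by exists (rnorm (x0 - 0)), 0.
  by exists 0 => _ [y _ <-]; apply: rnorm_ge0.
have Dlb y : M y -> inf D <= rnorm (x0 - y).
  by move=> My; apply: ge_inf => //; [apply: Dinf.2|exists y].
set d := inf D in Dlb; have ed : e <= d.
  by apply: lb_le_inf => [|_ [y My <-]]; [exact: Dinf.1|apply: far].
have /choice[m mP] (n : nat) : exists y, M y /\ rnorm (x0 - y) < d + n.+1%:R^-1.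
  have [|_ [y My <-] yd] := @inf_adherent _ D n.+1%:R^-1 _ Dinf.
    by rewrite invr_gt0.
  by exists y.
(* The midpoint of [y] and [z] lies in [M], at distance at least [d] from [x0]. *)
have mid y z : M y -> M z -> d *+ 2 <= rnorm ((x0 - y) + (x0 - z)).
  move=> My Mz.
  have h : M (2^-1 *: y + 2^-1 *: z).
    by apply/Mlin => //; rewrite -[_ *: z]addr0; apply: Mlin.
  have -> : (x0 - y) + (x0 - z) =
     (2%:R : R)%:C%C *: (x0 - (2^-1 *: y + 2^-1 *: z)).
    rewrite -scalerDr rmorph_nat scalerBr scalerA divff ?scale1r ?pnatr_eq0//.
    by rewrite scaler_nat mulr2n opprD addrACA.
  by rewrite rnormZR gtr0_norm// mulr_natl ler_pMn2r ?Dlb.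
have inv_le N n : (N <= n)%N -> n.+1%:R^-1 <= N.+1%:R^-1 :> R.
  by move=> Nn; rewrite lef_pV2 ?posrE// ler_nat.
have inv_lt (c : R) : 0 < c -> exists N : nat, N.+1%:R^-1 < c.
  move=> c0; exists (Num.truncn c^-1); rewrite invf_plt ?posrE//.
  exact: truncnS_gt.
have [|l lP] := @cauchy_rnorm _ _ (fun n => x0 - m n).
  move=> r r0.
  (* Beyond [N] the squared distances are at most [d^2 + (2d + 1) / (N + 1)]; the parallelogram
     identity and [mid] then bound the squared gap between two terms by [4 (2d + 1) / (N + 1)]. *)
  have [|N NP] := inv_lt (r ^+ 2 / (4 * (d *+ 2 + 1))).
    by rewrite divr_gt0 ?exprn_gt0 ?mulr_gt0//; lra.
  have sq n : (N <= n)%N ->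
      rnorm (x0 - m n) ^+ 2 <= d ^+ 2 + (d *+ 2 + 1) * N.+1%:R^-1.
    move=> Nn; have [_ /ltW mn] := mP n.
    apply: le_trans (_ : (d + n.+1%:R^-1) ^+ 2 <= _).
      by rewrite lerXn2r ?nnegrE ?rnorm_ge0// addr_ge0 ?invr_ge0//; lra.
    have n1 : n.+1%:R^-1 <= 1 :> R by rewrite invf_le1 ?ler1n.
    have n0 : 0 < n.+1%:R^-1 :> R by rewrite invr_gt0.
    have := inv_le _ _ Nn; set p := n.+1%:R^-1 in n1 n0 *; set q := N.+1%:R^-1.
    by move=> pq; nra.
  exists N => i j Ni Nj.
  have [Mi _] := mP i; have [Mj _] := mP j.
  have P := parallelogram (x0 - m i) (x0 - m j).
  have Q : (d *+ 2) ^+ 2 <= rnorm (x0 - m i + (x0 - m j)) ^+ 2.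
    by rewrite lerXn2r ?nnegrE ?rnorm_ge0 ?mid// mulrn_wge0//; lra.
  have := sq _ Ni; have := sq _ Nj.
  rewrite ltr_pdivlMr in NP; last by lra.
  move: P Q NP; set A := rnorm (_ + _); set B := rnorm (_ - _).
  set q := N.+1%:R^-1; set ai := rnorm _; set aj := rnorm _ => P Q NP sj si.
  have : B ^+ 2 < r ^+ 2.
    rewrite mulr2n in P; rewrite !mulr2n in Q NP sj si; lra.
  by rewrite ltr_pXn2r// nnegrE ?rnorm_ge0// ltW.
have le_eps (a b : R) : (forall c : R, 0 < c -> a <= b + c) -> a <= b.
  by move=> ab; apply/ler_addgt0Pr => c c0; apply: ab.
have ld : rnorm l <= d.
  apply: le_eps => c c0; have [|N1 N1P] := lP (c / 2); first by rewrite divr_gt0.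
  have [|N2 N2P] := inv_lt (c / 2); first by rewrite divr_gt0.
  have := N1P (maxn N1 N2) (leq_maxl _ _); set k := maxn N1 N2.
  have [_ mk] := mP k; have := inv_le N2 k (leq_maxr _ _).
  have := rnorm_triangle l (x0 - m k) 0; rewrite !subr0 (rnormB l).
  move: mk N2P; set p : R := k.+1%:R^-1; set q : R := N2.+1%:R^-1.
  by lra.
have dl y : M y -> d <= rnorm (l - y).
  move=> My; apply: le_eps => c c0; have [N NP] := lP _ c0.
  have [Mn _] := mP N; have := NP _ (leqnn _).
  have := Dlb (1 *: m N + y) (Mlin _ _ _ Mn My).
  have := rnorm_triangle (x0 - m N) l y; rewrite scale1r opprD addrA.
  by lra.
(* The limit [l] of [x0 - m n] is the residual of the projection of [x0] on the closure of [M]. It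
   has norm at most [d], while every [l - y] has norm at least [d], which is positive. *)
exists l => [|y My]; last first.
  apply: minimal_orth => a; apply: le_trans ld _; apply: dl.
  by rewrite -[a *: y]addr0; apply: Mlin.
apply/eqP => l0; have := dl 0 M0; rewrite l0 subr0 rnorm0; lra.
Qed.

End inner_product.

Section combinations.
Context (R : realType).
Implicit Types V W : lmodType R[i].

(** A list may repeat an index, which turns concatenation into addition; [comb_undup] collects
    coefficients when Pythagoras requires distinct indices. *)
Definition comb V (I : Type) (e : I -> V) (l : seq (R[i] * I)) : V :=
  \sum_(p <- l) p.1 *: e p.2.

Lemma comb_cat V (I : Type) (e : I -> V) l1 l2 :
  comb e (l1 ++ l2) = comb e l1 + comb e l2.
Proof. exact: big_cat. Qed.

Lemma combZ V (I : Type) (e : I -> V) a l :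
  comb e [seq (a * p.1, p.2) | p <- l] = a *: comb e l.
Proof.
by rewrite /comb big_map scaler_sumr; apply: eq_bigr => p _; rewrite scalerA.
Qed.

Lemma linear_comb V W (u : {linear V -> W}) (I : Type) (e : I -> V) l :
  u (comb e l) = comb (u \o e) l.
Proof.
by rewrite /comb linear_sum; apply: eq_bigr => p _; rewrite linearZ_LR.
Qed.

Lemma comb_undup V (I : eqType) (e : I -> V) l :
  comb e l = \sum_(i <- undup (map snd l)) (\sum_(p <- l | p.2 == i) p.1) *: e i.
Proof.
under [RHS]eq_bigr => i _ do rewrite scaler_suml.
rewrite (exchange_big_dep xpredT)//= /comb big_seq [RHS]big_seq.
apply: eq_bigr => p pl; rewrite -big_filter (_ : seq.filter _ _ = [:: p.2]) ?big_seq1//.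
rewrite -(@filter_pred1_uniq _ (undup (map snd l)) p.2) ?undup_uniq//.
  by apply: eq_filter => i; rewrite /= eq_sym.
by rewrite mem_undup map_f.
Qed.

Lemma linearP_pack V W (f : V -> W) : linear f -> exists g : {linear V -> W}, g =1 f.
Proof.
move=> lf; pose gl := GRing.isLinear.Build _ _ _ _ _ lf.
pose g : {linear V -> W} := HB.pack f gl.
by exists g.
Qed.

End combinations.

(** * Orthonormal bases *)

Section basis.
Context (R : realType) (H : completeNormedModType R[i]).
Context (dot : {dot H for (Num.conj : R[i] -> R[i])}).
Context (dotE : forall x : H, `|x| ^+ 2 = dot x x).

Definition on_family (I : eqType) (e : I -> H) :=
  forall i j, dot (e i) (e j) = (i == j)%:R.

Definition on_basis (I : eqType) (e : I -> H) := on_family e /\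
  forall x (r : R), 0 < r -> exists l, rnorm (x - comb e l) < r.

Lemma rnorm_unit x : dot x x = 1 -> rnorm x = 1.
Proof.
rewrite (dot_rnorm dotE) => h.
have /eqP : rnorm x ^+ 2 = 1 by apply: complexI; rewrite h.
by rewrite sqrf_eq1 => /orP[/eqP//|/eqP h1]; have := rnorm_ge0 x; rewrite h1; lra.
Qed.

Lemma on_family_rnorm (I : eqType) (e : I -> H) i : on_family e -> rnorm (e i) = 1.
Proof. by move=> eon; apply: rnorm_unit; rewrite eon eqxx. Qed.

Lemma on_family_dist (I : eqType) (e : I -> H) i j : on_family e -> i != j ->
  1 <= rnorm (e i - e j).
Proof.
move=> ef ij; have := rnormD_orth dotE (x := e i) (y := - e j).
rewrite dotNr ef (negPf ij) oppr0 rnormN !(on_family_rnorm _ ef) => /(_ erefl) h.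
have := rnorm_ge0 (e i - e j); set r := rnorm _ in h *; move=> r0.
by rewrite -(@expr_ge1 _ 2)// h; lra.
Qed.

(** A maximal orthonormal set, indexed by itself. If its span were not dense, [orth_nondense] would
    give a nonzero vector orthogonal to it, and normalising that vector would enlarge the set. *)
Lemma exists_on_basis : exists (I : choiceType) (e : I -> H), on_basis e.
Proof.
pose P := [set J : set H | forall x y, J x -> J y -> dot x y = (x == y)%:R].
have [F FP Ftot x y [A FA Ax] [B FB By]|J [JP Jmax]] := @Zorn_bigcup _ P.
  by have [/(_ _ Ax)|/(_ _ By)] := Ftot _ _ FA FB => h;
    [apply: (FP _ FB)|apply: (FP _ FA)].
exists (set_type J), val; split.
  by move=> i j; apply: JP; apply: set_mem; apply: valP.
move=> x r r0; apply: contrapT => /forallNP far.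
have [|||y [l _ <-]|w w0 wJ] :=
    @orth_nondense _ _ _ dotE (range (comb (val : J -> H))) x r.
- by exists [::] => //; rewrite /comb big_nil.
- move=> a _ _ [l1 _ <-] [l2 _ <-].
  by exists ([seq (a * p.1, p.2) | p <- l1] ++ l2) => //; rewrite comb_cat combZ.
- by [].
- by rewrite leNgt; apply/negP/far.
have wJ0 y : J y -> dot w y = 0.
  move=> Jy; apply: wJ; exists [:: (1, SigSub (mem_set Jy))] => //.
  by rewrite /comb big_seq1 scale1r.
have rw := rnorm_gt0 w0.
pose v := (rnorm w)^-1%:C%C *: w.
have vv : dot v v = 1.
  rewrite (dot_rnorm dotE) rnormZR ger0_norm ?invr_ge0 ?(ltW rw)//.
  by rewrite mulVf ?gt_eqF// expr1n.
have vJ y : J y -> dot v y = 0 by move=> Jy; rewrite dotZl wJ0// mulr0.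
have nJv : ~ J v by move=> /vJ/eqP; rewrite vv oner_eq0.
apply: (Jmax (J `|` [set v])).
  by split; [exact: subsetUl|move=> /(_ v (or_intror erefl))].
move=> y z [Jy|->] [Jz|->].
- exact: JP.
- rewrite (dot_eq0C (vJ _ Jy)); case: eqP => // yv; by rewrite -yv in nJv.
- rewrite vJ//; case: eqP => // zv; by rewrite zv in nJv.
- by rewrite vv eqxx.
Qed.

(** A vector of [s] whose residual is zero adds nothing to the system, so [N] is the dimension of
    the span rather than the length of [s]. Only the values of [a] below [N] matter. *)
Lemma gram_schmidt (s : seq H) : exists N (a : nat -> H),
  (forall i j, (i < N)%N -> (j < N)%N -> dot (a i) (a j) = (i == j)%:R) /\
  forall x, x \in s -> x = \sum_(i < N) dot x (a i) *: a i.
Proof.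
elim: s => [|x s [N [a [aon sa]]]]; first by exists 0%N, (fun=> 0).
pose y := x - \sum_(i < N) dot x (a i) *: a i.
have ya i : (i < N)%N -> dot y (a i) = 0.
  move=> iN; rewrite dotDl dotNl dot_suml (bigD1 (Ordinal iN))//= dotZl aon// eqxx.
  rewrite mulr1 big1 ?addr0 ?subrr// => j ji; rewrite dotZl aon// -val_eqE/= in ji *.
  by rewrite (negPf ji) mulr0.
have [y0|y0] := eqVneq y 0.
  exists N, a; split=> // z; rewrite inE => /orP[/eqP ->|/sa//].
  by apply/eqP; rewrite -subr_eq0; apply/eqP.
have ry := rnorm_gt0 y0.
pose v := (rnorm y)^-1%:C%C *: y.
have va i : (i < N)%N -> dot v (a i) = 0 by move=> iN; rewrite dotZl ya// mulr0.
pose b i := if i == N then v else a i.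
have bN : b N = v by rewrite /b eqxx.
have ba i : (i < N)%N -> b i = a i by move=> iN; rewrite /b ltn_eqF.
have bsum z : \sum_(i < N.+1) dot z (b i) *: b i =
    \sum_(i < N) dot z (a i) *: a i + dot z v *: v.
  by rewrite big_ord_recr/= bN; congr (_ + _); apply: eq_bigr => i _; rewrite ba.
exists N.+1, b; split=> [i j|z].
  rewrite !ltnS leq_eqVlt => /orP[/eqP ->|iN]; rewrite leq_eqVlt => /orP[/eqP ->|jN].
  - rewrite bN eqxx (dot_rnorm dotE) rnormZR ger0_norm ?invr_ge0 ?(ltW ry)//.
    by rewrite mulVf ?gt_eqF// expr1n.
  - by rewrite bN ba// va// gtn_eqF.
  - by rewrite bN ba// (dot_eq0C (va _ iN)) ltn_eqF.
  - by rewrite !ba// aon.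
rewrite inE bsum => /orP[/eqP ->|zs]; last first.
  have zv : dot z v = 0.
    apply: dot_eq0C; rewrite {1}(sa z zs) dot_sumr big1// => i _.
    by rewrite dotZr va// mulr0.
  by rewrite zv scale0r addr0 -sa.
have xE : x = \sum_(i < N) dot x (a i) *: a i + y by rewrite /y addrC subrK.
have -> : dot x v = (rnorm y)%:C%C.
  rewrite {1}xE dotDl dot_suml big1 ?add0r => [|i _]; last first.
    by rewrite dotZl (dot_eq0C (va _ _))// mulr0.
  rewrite dotZr conjR (dot_rnorm dotE) -rmorphM/=; congr (_%:C)%C.
  by rewrite expr2 mulrA mulVf ?mul1r// gt_eqF.
by rewrite scalerA -rmorphM/= divff ?gt_eqF// scale1r.
Qed.

Lemma bessel N (a : nat -> H) (x : H) :
  (forall i j, (i < N)%N -> (j < N)%N -> dot (a i) (a j) = (i == j)%:R) ->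
  \sum_(i < N) cabs (dot x (a i)) ^+ 2 <= rnorm x ^+ 2.
Proof.
move=> aon; pose p := \sum_(i < N) dot x (a i) *: a i.
have pE : rnorm p ^+ 2 = \sum_(i < N) cabs (dot x (a i)) ^+ 2.
  rewrite (rnorm_sum_orth dotE) ?index_enum_uniq//.
    apply: eq_bigr => i _; rewrite rnormZc exprMn.
    suff -> : rnorm (a i) ^+ 2 = 1 by rewrite mulr1.
    by apply: complexI; rewrite -(dot_rnorm dotE) aon// eqxx.
  by move=> i j ij; rewrite dotZl dotZr aon// -val_eqE/= in ij *;
    rewrite (negPf ij) !mulr0.
have xp : dot (x - p) p = 0.
  rewrite {2}/p dot_sumr big1// => i _; rewrite dotZr dotDl dotNl.
  rewrite /p dot_suml (bigD1 i)//= dotZl aon// eqxx.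
  rewrite mulr1 big1 ?addr0 ?subrr ?mulr0// => j ji.
  by rewrite dotZl aon// -val_eqE/= in ji *; rewrite (negPf ji) mulr0.
rewrite -pE -[x in leRHS](subrK p) (rnormD_orth dotE xp) lerDr.
exact: sqr_ge0.
Qed.

End basis.

(** * Operators defined on orthonormal systems *)

Section operators.
Context (R : realType) (H K : completeNormedModType R[i]).

(* T is the closure of the graph G. *)
Lemma extend_contraction (G : H -> K -> Prop) :
  (forall a x x' y y', G x y -> G x' y' -> G (a *: x + x') (a *: y + y')) ->
  (forall x y, G x y -> rnorm y <= rnorm x) ->
  (forall x (r : R), 0 < r -> exists x' y', G x' y' /\ rnorm (x - x') < r) ->
  exists T : {linear H -> K}, bounded_by T 1 /\ forall x y, G x y -> T x = y.
Proof.
move=> Glin Gle Gdense.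
pose cl x y := forall r : R, 0 < r ->
  exists x' y', [/\ G x' y', rnorm (x - x') < r & rnorm (y - y') < r].
have cl_le x y : cl x y -> rnorm y <= rnorm x.
  move=> xy; apply/ler_addgt0Pr => r r0.
  have [|x' [y' [/Gle yx' xx' yy']]] := xy (r / 2); first by rewrite divr_gt0.
  have := rnorm_triangle y y' 0; have := rnorm_triangle x' x 0.
  by rewrite !subr0 (rnormB x'); lra.
have cl_lin a x x' y y' : cl x y -> cl x' y' -> cl (a *: x + x') (a *: y + y').
  move=> xy xy' r r0; have a0 := cabs_ge0 a.
  have r1 : 0 < r / (cabs a + 1) by rewrite divr_gt0//; lra.
  have [|u [v [uv xu yv]]] := xy (r / (cabs a + 1) / 2); first by rewrite divr_gt0.
  have [|u' [v' [uv' xu' yv']]] := xy' (r / 2); first by rewrite divr_gt0.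
  exists (a *: u + u'), (a *: v + v'); split; first exact: Glin.
    rewrite opprD addrACA -scalerBr (le_lt_trans (rnormD _ _))// rnormZc.
    suff : cabs a * rnorm (x - u) <= r / 2 by lra.
    apply: le_trans (_ : cabs a * (r / (cabs a + 1) / 2) <= _).
      by rewrite ler_wpM2l// ltW.
    rewrite mulrA ler_pM2r// mulrA ler_pdivrMr; last by lra.
    by rewrite mulrC ler_pM2l//; lra.
  rewrite opprD addrACA -scalerBr (le_lt_trans (rnormD _ _))// rnormZc.
  suff : cabs a * rnorm (y - v) <= r / 2 by lra.
  apply: le_trans (_ : cabs a * (r / (cabs a + 1) / 2) <= _).
    by rewrite ler_wpM2l// ltW.
  rewrite mulrA ler_pM2r// mulrA ler_pdivrMr; last by lra.
  by rewrite mulrC ler_pM2l//; lra.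
have cl_sub x y : G x y -> cl x y.
  by move=> xy r r0; exists x, y; rewrite !subrr !rnorm0.
have cl_fun x y y' : cl x y -> cl x y' -> y = y'.
  move=> xy xy'; have := cl_lin (-1) _ _ _ _ xy xy'.
  rewrite !scaleN1r addNr => /cl_le; rewrite rnorm0 => h.
  apply/eqP; rewrite eq_sym -subr_eq0 addrC; apply/eqP/rnorm_eq0.
  by apply: le_anti; rewrite h rnorm_ge0.
(* For graph points whose first components tend to [x], the second components differ by no more than
   the first ones do, hence are Cauchy. *)
have cl_ex x : exists y, cl x y.
  have /choice[u uP] (n : nat) : exists u : H * K,
      G u.1 u.2 /\ rnorm (x - u.1) < n.+1%:R^-1.
    by have [|x' [y' h]] := Gdense x n.+1%:R^-1; [rewrite invr_gt0|exists (x', y')].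
  have small (c : R) : 0 < c -> exists N : nat, forall n, (N <= n)%N ->
      rnorm (x - (u n).1) < c.
    move=> c0; exists (Num.truncn c^-1) => n Nn; have [_ /lt_trans->//] := uP n.
    rewrite invf_plt ?posrE//; apply: lt_le_trans (truncnS_gt _) _.
    by rewrite ler_nat.
  have [|l lP] := @cauchy_rnorm _ _ (fun n => (u n).2).
    move=> r r0; have [|N NP] := small (r / 2); first by rewrite divr_gt0.
    exists N => m n Nm Nn.
    have : rnorm ((u m).2 - (u n).2) <= rnorm ((u m).1 - (u n).1).
      have [um _] := uP m; have [un _] := uP n.
      have /Gle := Glin (-1) _ _ _ _ um un.
      by rewrite !scaleN1r ![- _ + _]addrC rnormB => h; rewrite [leRHS]rnormB.
    have := rnorm_triangle (u m).1 x (u n).1.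
    by rewrite (rnormB _ x); have := NP _ Nm; have := NP _ Nn; lra.
  exists l => r r0; have [N1 N1P] := lP _ r0; have [N2 N2P] := small _ r0.
  exists (u (maxn N1 N2)).1, (u (maxn N1 N2)).2.
  rewrite N2P ?leq_maxr// rnormB N1P ?leq_maxl//; split=> //.
  by have [] := uP (maxn N1 N2).
have [T0 T0P] := choice cl_ex.
have [T TE] : exists T : {linear H -> K}, T =1 T0.
  apply: linearP_pack => a x y; apply: cl_fun (T0P _) _.
  exact: cl_lin.
exists T; split=> [x|x y xy]; rewrite TE ?mul1r; first exact: cl_le.
by apply: cl_fun (T0P _) _; apply: cl_sub.
Qed.

Context (dotH : {dot H for (Num.conj : R[i] -> R[i])}).
Context (dotHE : forall x : H, `|x| ^+ 2 = dotH x x).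
Context (dotK : {dot K for (Num.conj : R[i] -> R[i])}).
Context (dotKE : forall x : K, `|x| ^+ 2 = dotK x x).

(** Pythagoras on both sides shows that [comb e l] to [comb g l] does not increase norms. Working
    with the graph of this relation postpones single-valuedness, which the norm bound supplies. *)
Lemma contraction_of_basis (I : eqType) (e : I -> H) (g : I -> K) :
  on_basis dotH e -> (forall i j, i != j -> dotK (g i) (g j) = 0) ->
  (forall i, rnorm (g i) <= 1) ->
  exists T : {linear H -> K}, bounded_by T 1 /\ forall i, T (e i) = g i.
Proof.
move=> [eon edense] gorth g1.
pose G x y := exists l, x = comb e l /\ y = comb g l.
have [|_ _ [l [-> ->]]|x r r0|T [T1 TG]] := @extend_contraction G.
- move=> a _ _ _ _ [l [-> ->]] [l' [-> ->]].
  exists ([seq (a * p.1, p.2) | p <- l] ++ l').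
  by rewrite !comb_cat !combZ.
- suff : rnorm (comb g l) ^+ 2 <= rnorm (comb e l) ^+ 2.
    by rewrite ler_pXn2r ?nnegrE ?rnorm_ge0.
  rewrite !comb_undup (rnorm_sum_orth dotKE) ?undup_uniq//; last first.
    by move=> i j ij; rewrite dotZl dotZr gorth// !mulr0.
  rewrite (rnorm_sum_orth dotHE) ?undup_uniq//; last first.
    by move=> i j ij; rewrite dotZl dotZr eon (negPf ij) !mulr0.
  apply: ler_sum => i _; rewrite !rnormZc !exprMn ler_wpM2l ?sqr_ge0//.
  by rewrite lerXn2r ?nnegrE ?rnorm_ge0// (on_family_rnorm dotHE _ eon).
- by have [l lP] := edense x r r0; exists (comb e l), (comb g l); split=> //; exists l.
exists T; split=> // i; apply: TG; exists [:: (1, i)].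
by rewrite /comb !big_seq1 !scale1r.
Qed.

(** Pythagoras for the orthogonal [b i], then Bessel for the orthonormal [a i]. *)
Lemma finite_rank_bound N (a : nat -> H) (b : nat -> K) (M : R) :
  (forall i j, (i < N)%N -> (j < N)%N -> dotH (a i) (a j) = (i == j)%:R) ->
  (forall i j, (i < N)%N -> (j < N)%N -> i != j -> dotK (b i) (b j) = 0) ->
  (forall i, (i < N)%N -> rnorm (b i) <= M) -> 0 <= M ->
  exists T : {linear H -> K}, bounded_by T M /\
    forall x, T x = \sum_(i < N) dotH x (a i) *: b i.
Proof.
move=> aon borth bM M0.
have [|T TE] := @linearP_pack _ H K (fun x => \sum_(i < N) dotH x (a i) *: b i).
  move=> c x y; rewrite scaler_sumr -big_split/=; apply: eq_bigr => i _.
  by rewrite dotDl dotZl scalerDl scalerA.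
exists T; split=> // x; rewrite TE.
suff : rnorm (\sum_(i < N) dotH x (a i) *: b i) ^+ 2 <= (M * rnorm x) ^+ 2.
  by rewrite ler_pXn2r ?nnegrE ?mulr_ge0 ?rnorm_ge0.
rewrite (rnorm_sum_orth dotKE) ?index_enum_uniq//; last first.
  by move=> i j ij; rewrite dotZl dotZr borth// !mulr0.
rewrite exprMn; apply: le_trans (_ : M ^+ 2 * \sum_(i < N) cabs (dotH x (a i)) ^+ 2 <= _).
  rewrite mulr_sumr; apply: ler_sum => i _.
  rewrite rnormZc exprMn mulrC ler_wpM2r ?sqr_ge0//.
  by rewrite lerXn2r ?nnegrE ?rnorm_ge0// bM.
by rewrite ler_wpM2l ?sqr_ge0// (bessel dotHE).
Qed.

End operators.

(** * Gliding hump *)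

Section finite_codimension.
Context (R : realType) (V : lmodType R[i]).

(** Finite codimension means being cut out by finitely many linear functionals; the inductive form
    lets proofs remove one functional at a time. *)
Inductive fincodim : set V -> Prop :=
| fincodimT : fincodim setT
| fincodim_ker S (phi : V -> R[i]) : fincodim S ->
    (forall a x y, phi (a *: x + y) = a * phi x + phi y) ->
    fincodim (S `&` [set x | phi x = 0]).

Lemma fincodim_submod S : fincodim S ->
  S 0 /\ forall a x y, S x -> S y -> S (a *: x + y).
Proof.
elim=> [//|{}S phi _ [S0 SD] phiL]; split=> [|a x y [Sx /= px] [Sy /= py]].
  split=> //=; have := phiL (-1) 0 0.
  by rewrite scaleN1r addNr mulN1r addNr.
by split; [exact: SD|rewrite /= phiL px py mulr0 addr0].
Qed.

Lemma fincodimI S S' : fincodim S -> fincodim S' -> fincodim (S `&` S').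
Proof.
move=> Sf; elim=> [|{}S' phi _ IH phiL]; first by rewrite setIT.
by rewrite setIA; apply: fincodim_ker.
Qed.

Definition spanned (S : set V) := exists n (e : nat -> V), forall x, S x ->
  exists c : nat -> R[i], x = \sum_(i < n) c i *: e i.

(** Dropping a functional [phi] costs at most one spanning vector: if [phi s] is nonzero,
    [x - (phi x / phi s) s] lies in the kernel. *)
Lemma spanned_fincodim S : fincodim S -> spanned S -> spanned setT.
Proof.
elim=> [//|{}S phi Sf IH phiL [n [e eS]]]; apply: IH.
have [S0 SD] := fincodim_submod Sf.
have [[s [Ss ps]]|/forallNP nS] := pselect (exists s, S s /\ phi s <> 0); last first.
  exists n, e => x Sx; apply: eS; split=> //=; apply: contrapT => px.
  by apply: (nS x).
exists n.+1, (fun i => if i == n then s else e i) => x Sx.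
have phi0 : phi 0 = 0.
  by have := phiL (-1) 0 0; rewrite scaleN1r addNr mulN1r addNr.
have [|c xE] := eS (- (phi x / phi s) *: s + x).
  split; first exact: SD.
  by rewrite /= phiL mulNr divfK ?addNr//; apply/eqP.
exists (fun i => if i == n then phi x / phi s else c i).
rewrite big_ord_recr/= eqxx; under eq_bigr => i _ do rewrite ltn_eqF//.
by rewrite -xE scaleNr addrAC addNr add0r.
Qed.

Lemma fincodim_neq0 S : ~ finite_dimensional V -> fincodim S ->
  exists2 x, S x & x != 0.
Proof.
move=> Vinf Sf; apply: contrapT => nS; apply: Vinf.
have [|n [e eV]] := spanned_fincodim Sf.
  exists 0%N, (fun=> 0) => x Sx; exists (fun=> 0); rewrite big_ord0.
  by apply/eqP; apply: contra_notT nS => x0; exists x.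
exists n, (fun i => e i) => x; have [//|c ->] := eV x.
by exists (fun i => c i).
Qed.

End finite_codimension.

Section gliding_hump.
Context (R : realType) (H K : completeNormedModType R[i]).
Context (dotH : {dot H for (Num.conj : R[i] -> R[i])}).
Context (dotHE : forall x : H, `|x| ^+ 2 = dotH x x).
Context (dotK : {dot K for (Num.conj : R[i] -> R[i])}).
Context (dotKE : forall x : K, `|x| ^+ 2 = dotK x x).

Lemma fincodim_orth (u : {linear H -> K}) (z : K) :
  fincodim [set x | dotK (u x) z = 0].
Proof.
rewrite -[X in fincodim X]setTI; apply: fincodim_ker; first exact: fincodimT.
by move=> a x y; rewrite linearP dotDl dotZl.
Qed.

Lemma fincodim_unit (S : set H) : ~ finite_dimensional H -> fincodim S ->
  exists2 x, S x & rnorm x = 1.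
Proof.
move=> Hinf Sf; have [x Sx x0] := fincodim_neq0 Hinf Sf.
have [S0 SD] := fincodim_submod Sf; have rx := rnorm_gt0 x0.
exists ((rnorm x)^-1%:C%C *: x).
  by rewrite -[_ *: x]addr0; apply: SD.
by rewrite rnormZR ger0_norm ?invr_ge0 ?(ltW rx)// mulVf// gt_eqF.
Qed.

(** With a finite basis [f], the vectors [x] with [u x] orthogonal to every [f j] would contain a
    subspace of finite codimension on which [u] vanishes. *)
Lemma infinite_basis (u : {linear H -> K}) (J : choiceType) (f : J -> K) :
  (forall S : set H, fincodim S -> exists2 x, S x & u x != 0) -> on_basis dotK f ->
  infinite_set [set: J].
Proof.
move=> uS [_ fdense] /finite_seqP[s sJ].
have [x sx ux] : exists2 x, (forall j, j \in s -> dotK (u x) (f j) = 0) & u x != 0.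
  suff [S [Sf SP]] : exists S : set H, fincodim S /\
      forall x, S x -> forall j, j \in s -> dotK (u x) (f j) = 0.
    by have [x Sx ux] := uS S Sf; exists x => //; apply: SP.
  elim: s {sJ} => [|j s [S [Sf SP]]];
    first by exists setT; split=> //; exact: fincodimT.
  exists (S `&` [set x | dotK (u x) (f j) = 0]); split.
    by apply: fincodimI => //; apply: fincodim_orth.
  by move=> x [/SP Sx xj] k; rewrite inE => /orP[/eqP ->//|]; apply: Sx.
have xf j : dotK (u x) (f j) = 0.
  by apply: sx; have : [set` s] j by rewrite -sJ.
have [l] := fdense (u x) _ (rnorm_gt0 ux).
have : rnorm (u x) ^+ 2 <= rnorm (u x - comb f l) ^+ 2.
  rewrite (rnormD_orth dotKE) ?lerDl ?sqr_ge0//.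
  rewrite dotNr dot_sumr big1 ?oppr0// => p _.
  by rewrite dotZr xf mulr0.
rewrite ler_pXn2r ?nnegrE ?rnorm_ge0// => h1 h2.
by have := le_lt_trans h1 h2; rewrite ltxx.
Qed.

Context (Hinf : ~ finite_dimensional H).
Context (T : nat -> {linear H -> K}) (C delta : R).
Context (C0 : 0 <= C) (delta0 : 0 < delta).
Context (TC : forall n, bounded_by (T n) C).
Context (Tcvg : forall x (r : R), 0 < r ->
  exists N, forall n, (N <= n)%N -> rnorm (T n x) < r).
Context (Tlow : forall x (t : R), (forall n, rnorm (T n x) <= t) ->
  delta * rnorm x <= t).

(* Otherwise each T_n is uniformly small on the unit sphere of a subspace of
   finite codimension, and one builds y_m, a sum of m orthonormal vectors
   essentially disjointly supported in c_0(K): the norm of (T_n y_m)_n stays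
   bounded while |y_m|^2 = m. *)
Lemma exists_noncompact_coordinate : exists n c, 0 < c /\
  forall S : set H, fincodim S -> exists x, [/\ S x, rnorm x = 1 & c <= rnorm (T n x)].
Proof.
apply: contrapT => nT.
have small n c : 0 < c -> exists2 S : set H, fincodim S &
    forall x, S x -> rnorm x = 1 -> rnorm (T n x) < c.
  move=> c0; apply: contrapT => nS; apply: nT; exists n, c; split=> // S Sf.
  apply: contrapT => /forallNP nx; apply: nS; exists S => // x Sx x1.
  by rewrite ltNge; apply/negP => cx; apply: (nx x).
have smallN N c : 0 < c -> exists2 S : set H, fincodim S &
    forall n x, (n < N)%N -> S x -> rnorm x = 1 -> rnorm (T n x) < c.
  move=> c0; elim: N => [|N [S Sf SP]]; first by exists setT => //; exact: fincodimT.
  have [S' Sf' SP'] := small N c c0.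
  exists (S `&` S'); first exact: fincodimI.
  move=> n x; rewrite ltnS leq_eqVlt => /orP[/eqP -> [_]|nN [Sx _]]; first exact: SP'.
  exact: SP.
(* Each new vector [x] costs only [c]: from [N] on the coordinates of [y] are below [c] and those of
   [x] at most [C]; before [N] those of [x] are below [c] and the old bound holds for [y]. *)
have hump (c : R) m : 0 < c -> exists y, rnorm y ^+ 2 = m%:R /\
    forall n, rnorm (T n y) <= C + m%:R * c.
  move=> c0; elim: m => [|m [y [ym yT]]].
    exists 0; split=> [|n]; first by rewrite rnorm0 expr0n.
    by rewrite linear0 rnorm0 mul0r addr0.
  have [N NP] := Tcvg y c0; have [S Sf SP] := smallN N c c0.
  have yf : fincodim [set x | dotH x y = 0].
    rewrite -[X in fincodim X]setTI; apply: fincodim_ker; first exact: fincodimT.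
    by move=> a u v; rewrite dotDl dotZl.
  have [x [Sx xy] x1] := fincodim_unit Hinf (fincodimI Sf yf).
  exists (y + x); split=> [|n].
    by rewrite (rnormD_orth dotHE) ?(dot_eq0C xy)// ym x1 expr1n natr1.
  rewrite linearD (le_trans (rnormD _ _))// -natr1 mulrDl mul1r.
  have [Nn|nN] := leqP N n.
    have := NP n Nn; have := TC n x; rewrite x1 mulr1.
    have : 0 <= m%:R * c by rewrite mulr_ge0// ltW.
    by lra.
  by have := SP n x nN Sx x1; have := yT n; lra.
(* With [m + 1] vectors and slack [1 / (m + 1)] the coordinates stay below [C + 1], while the
   squared norm [m + 1] exceeds [((C + 1) / delta)^2]. *)
pose m := Num.truncn (((C + 1) / delta) ^+ 2).
have m0 : 0 < m.+1%:R :> R by [].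
have [|y [ym yT]] := hump m.+1%:R^-1 m.+1; first by rewrite invr_gt0.
have : delta * rnorm y <= C + 1.
  by apply: Tlow => n; have := yT n; rewrite divff// gt_eqF.
rewrite -ler_pdivlMl// mulrC => h.
have : rnorm y ^+ 2 <= ((C + 1) / delta) ^+ 2.
  by rewrite lerXn2r ?nnegrE ?rnorm_ge0// divr_ge0 ?(ltW delta0)// addr_ge0.
by rewrite ym leNgt truncnS_gt.
Qed.

(** The next vector is taken in the finite-codimensional subspace where it is orthogonal to the
    earlier ones and its image to their images; [n] and [c] stay the same throughout. *)
Lemma exists_orth_images : exists n c, [/\ 0 < c,
  (forall S : set H, fincodim S -> exists2 x, S x & T n x != 0) &
  forall N, exists a : nat -> H,
  [/\ forall i j, (i < N)%N -> (j < N)%N -> dotH (a i) (a j) = (i == j)%:R,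
      forall i j, (i < N)%N -> (j < N)%N -> i != j ->
        dotK (T n (a i)) (T n (a j)) = 0 &
      forall i, (i < N)%N -> c <= rnorm (T n (a i))]].
Proof.
have [n [c [c0 Tn]]] := exists_noncompact_coordinate.
exists n, c; split=> // [S Sf|].
  have [x [Sx _ cx]] := Tn S Sf; exists x => //.
  by apply: contraTneq cx => ->; rewrite rnorm0 -ltNge.
elim=> [|N [a [aon aorth ac]]]; first by exists (fun=> 0).
have [S [Sf SP]] : exists S : set H, fincodim S /\ forall x, S x ->
    forall i, (i < N)%N -> dotH x (a i) = 0 /\ dotK (T n x) (T n (a i)) = 0.
  elim: {aon aorth ac} N => [|N [S [Sf SP]]];
    first by exists setT; split=> //; exact: fincodimT.
  exists (S `&` [set x | dotH x (a N) = 0] `&` [set x | dotK (T n x) (T n (a N)) = 0]).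
  split.
    apply: fincodimI; last exact: fincodim_orth.
    by apply: fincodim_ker => // b x y; rewrite dotDl dotZl.
  move=> x [[/SP Sx xa] xTa] i; rewrite ltnS leq_eqVlt => /orP[/eqP ->//|].
  exact: Sx.
have [x [Sx x1 cx]] := Tn S Sf.
exists (fun i => if i == N then x else a i); split=> [i j|i j|i].
- rewrite !ltnS leq_eqVlt => /orP[/eqP ->|iN]; rewrite leq_eqVlt => /orP[/eqP ->|jN].
  + by rewrite !eqxx (dot_rnorm dotHE) x1 expr1n.
  + by rewrite eqxx (ltn_eqF jN) gtn_eqF//; case: (SP x Sx j jN).
  + by rewrite eqxx (ltn_eqF iN); apply: dot_eq0C; case: (SP x Sx i iN).
  + by rewrite (ltn_eqF iN) (ltn_eqF jN) aon.
- rewrite !ltnS leq_eqVlt => /orP[/eqP ->|iN]; rewrite leq_eqVlt => /orP[/eqP ->|jN].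
  + by rewrite eqxx.
  + by rewrite eqxx (ltn_eqF jN); case: (SP x Sx j jN).
  + by rewrite eqxx (ltn_eqF iN) => _; apply: dot_eq0C; case: (SP x Sx i iN).
  + by rewrite (ltn_eqF iN) (ltn_eqF jN); apply: aorth.
- rewrite ltnS leq_eqVlt => /orP[/eqP ->|iN]; first by rewrite eqxx.
  by rewrite (ltn_eqF iN) ac.
Qed.

End gliding_hump.

(** * Density and dimension *)

Section density.
Context (R : realType) (H : completeNormedModType R[i]).
Context (dotH : {dot H for (Num.conj : R[i] -> R[i])}).

Lemma eq_on_basis (W : normedModType R[i]) (I : eqType) (e : I -> H)
    (u v : {linear H -> W}) (M : R) : on_basis dotH e ->
  bounded_by u M -> bounded_by v M -> (forall i, u (e i) = v (e i)) -> u =1 v.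
Proof.
move=> [_ edense] /bounded_by_ge0 uM /bounded_by_ge0 vM uv x.
set N := `|M| in uM vM; have N0 : 0 <= N by rewrite normr_ge0.
apply/eqP; rewrite -subr_eq0; apply/eqP/rnorm_eq0/le_anti.
rewrite rnorm_ge0 andbT; apply/ler_addgt0Pr => r r0; rewrite add0r.
have [|l lP] := edense x (r / (2 * (N + 1))); first by rewrite divr_gt0// mulr_gt0//; lra.
have uvl : u (comb e l) = v (comb e l).
  by rewrite !linear_comb /comb; apply: eq_bigr => p _; rewrite /= uv.
have := rnorm_triangle (u x) (u (comb e l)) (v x).
rewrite {2}uvl -!linearB => h; apply: le_trans h _.
move: lP; rewrite ltr_pdivlMr; last by rewrite mulr_gt0//; lra.
have := uM (x - comb e l); have := vM (comb e l - x); rewrite (rnormB _ x).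
have := rnorm_ge0 (x - comb e l); set t := rnorm _ => t0 h1 h2 h3.
by apply: le_trans (lerD h2 h1) _; nra.
Qed.

End density.

Section dense_families.
Context (R : realType).

Definition rat_complex (q : rat * rat) : R[i] := (ratr q.1 +i* ratr q.2)%C.

Lemma dense_rat_complex (a : R[i]) (r : R) : 0 < r ->
  exists q, cabs (a - rat_complex q) < r.
Proof.
move=> r0; have approx (x : R) : exists q : rat, `|x - ratr q| < r / 2.
  have [|q] := @rat_in_itvoo _ (x - r / 2) (x + r / 2); first by lra.
  rewrite in_itv/= => /andP[q1 q2]; exists q.
  by rewrite ltr_norml; apply/andP; split; lra.
case: a => x y; have [p px] := approx x; have [q qy] := approx y.
exists (p, q); rewrite /rat_complex /cabs normc_def /=.
rewrite -(@ltr_pXn2r _ 2) ?nnegrE ?sqrtr_ge0 ?(ltW r0)//.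
rewrite sqr_sqrtr ?addr_ge0 ?sqr_ge0// -[_ ^+ 2]real_normK ?num_real//.
rewrite -[X in _ + X < _]real_normK ?num_real//.
have : `|x - ratr p| ^+ 2 < (r / 2) ^+ 2 by rewrite ltrXn2r ?nnegrE ?normr_ge0//; lra.
have : `|y - ratr q| ^+ 2 < (r / 2) ^+ 2 by rewrite ltrXn2r ?nnegrE ?normr_ge0//; lra.
rewrite exprMn; nra.
Qed.

Context (K : completeNormedModType R[i]).
Context (dotK : {dot K for (Num.conj : R[i] -> R[i])}).
Context (dotKE : forall x : K, `|x| ^+ 2 = dotK x x).

(** Combinations of the basis with coefficients in [Q + iQ] are dense, and as finite lists they
    inject into the infinite set [J], which can therefore index them. *)
Lemma dense_of_basis (J : choiceType) (f : J -> K) :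
  infinite_set [set: J] -> on_basis dotK f ->
  exists d : J -> K, forall y (r : R), 0 < r -> exists j, rnorm (y - d j) < r.
Proof.
move=> /seq_injection[sJ sJ_inj] [fon fdense].
(* The coefficient q of j is coded by the number of repetitions of j. *)
pose code (p : rat * rat * J) := sJ (nseq (pickle p.1).+1 p.2).
have nseq_inj m n (i j : J) : nseq m.+1 i = nseq n.+1 j -> m = n /\ i = j.
  by move=> mn; have := congr1 size mn; rewrite !size_nseq => -[->]; case: mn.
have code_inj : injective code.
  by move=> [p i] [q j] /sJ_inj /nseq_inj [/(pcan_inj pickleK) /= -> /= ->].
pose iota (l : seq (rat * rat * J)) := sJ (map code l).
have iota_inj : injective iota by move=> l m /sJ_inj /(inj_map code_inj).
pose dec j := xget [::] [set l | iota l = j].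
have iotaK l : dec (iota l) = l.
  by rewrite /dec; case: xgetP => [m _ /iota_inj//|/(_ l) []].
pose val (l : seq (rat * rat * J)) := comb f [seq (rat_complex p.1, p.2) | p <- l].
have approx l (r : R) : 0 < r -> exists m, rnorm (comb f l - val m) < r.
  elim: l r => [|[a j] l IH] r r0;
    first by exists [::]; rewrite /val /comb/= !big_nil subrr rnorm0.
  have [|m mP] := IH (r / 2); first by rewrite divr_gt0.
  have [|q qP] := @dense_rat_complex a (r / 2); first by rewrite divr_gt0.
  exists ((q, j) :: m); rewrite /val /comb /= !big_cons /= opprD addrACA -scalerBl.
  apply: le_lt_trans (rnormD _ _) _.
  rewrite rnormZc (on_family_rnorm dotKE _ fon) mulr1.
  by move: mP; rewrite /val /comb; lra.
exists (val \o dec) => y r r0.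
have [|l lP] := fdense y (r / 2); first by rewrite divr_gt0.
have [|m mP] := approx l (r / 2); first by rewrite divr_gt0.
exists (iota m); rewrite /= iotaK; have := rnorm_triangle y (comb f l) (val m).
by lra.
Qed.

Context (H : completeNormedModType R[i]).
Context (dotH : {dot H for (Num.conj : R[i] -> R[i])}).
Context (dotHE : forall x : H, `|x| ^+ 2 = dotH x x).

(** The list of [i] records approximations of the coordinates [T n (e i)] within [delta / 3]. If [i]
    and [j] shared a list, all coordinates of [e i - e j] would be at most [2 delta / 3], so its
    norm at most [2/3]; but distinct orthonormal vectors are at distance at least 1. *)
Lemma basis_injection (I J : choiceType) (e : I -> H) (d : J -> K)
    (T : nat -> {linear H -> K}) (delta : R) :
  on_family dotH e ->
  (forall y (r : R), 0 < r -> exists j, rnorm (y - d j) < r) ->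
  0 < delta ->
  (forall x (r : R), 0 < r ->
    exists N, forall n, (N <= n)%N -> rnorm (T n x) < r) ->
  (forall x (t : R), (forall n, rnorm (T n x) <= t) -> delta * rnorm x <= t) ->
  exists g : I -> seq J, injective g.
Proof.
move=> eon ddense delta0 Tcvg Tlow; pose r := delta / 3.
have r0 : 0 < r by rewrite divr_gt0.
(* The default 0 of [nth] approximates the coordinates beyond the end of the list, which are
   themselves small. *)
have /choice[g gP] i : exists s : seq J,
    forall n, rnorm (T n (e i) - nth 0 (map d s) n) < r.
  have [N NP] := Tcvg (e i) r r0.
  have /choice[h hP] n := ddense (T n (e i)) r r0.
  exists (mkseq h N) => n; have [Nn|nN] := leqP N n.
    by rewrite nth_default ?subr0 ?NP// size_map size_mkseq.
  by rewrite (nth_map (h 0%N)) ?size_mkseq// nth_mkseq// hP.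
exists g => i j gij; apply/eqP; apply: contraT => ij.
have : delta * rnorm (e i - e j) <= r * 2.
  apply: Tlow => n; rewrite linearB.
  have := gP i n; have := gP j n; rewrite gij; set z := nth _ _ _.
  by have := rnorm_triangle (T n (e i)) z (T n (e j)); rewrite (rnormB z); lra.
have := on_family_dist dotHE eon ij.
have : 0 <= delta by apply: ltW.
rewrite /r; set s := rnorm _ => d0 s1.
have ds : delta * 1 <= delta * s by rewrite ler_wpM2l.
by move=> h; have : delta < delta; [lra|rewrite ltxx].
Qed.

(** [V] sends [e i] to [f (s i)]; [P] sends [f (s i)] back to [e i] and kills the basis vectors
    outside the range of [s]. *)
Lemma basis_embedding (I J : choiceType) (e : I -> H) (f : J -> K) (s : I -> J) :
  on_basis dotH e -> on_basis dotK f -> injective s ->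
  exists (V : {linear H -> K}) (P : {linear K -> H}),
  [/\ bounded_by V 1, bounded_by P 1, cancel V P & (bijective s -> cancel P V)].
Proof.
move=> eb fb s_inj; have [eon _] := eb; have [fon _] := fb.
have [||V [V1 VE]] := contraction_of_basis dotHE dotKE (g := f \o s) eb.
- by move=> i j ij; rewrite /= fon (inj_eq s_inj) (negPf ij).
- by move=> i; rewrite /= (on_family_rnorm dotKE _ fon).
pose g j := if pselect (exists i, s i = j) is left h then e (projT1 (cid h)) else 0.
have gs i : g (s i) = e i.
  rewrite /g; case: pselect => [h|[]]; last by exists i.
  by case: cid => k /= /s_inj ->.
have gN j : (forall i, s i <> j) -> g j = 0.
  by move=> nj; rewrite /g; case: pselect => // h; have [i /nj] := h.
have [||P [P1 PE]] := contraction_of_basis dotKE dotHE (g := g) fb.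
- move=> j k jk; have [[i si]|/forallNP nj] := pselect (exists i, s i = j); last first.
    by rewrite gN// dot0l.
  have [[i' si']|/forallNP nk] := pselect (exists i, s i = k); last first.
    by rewrite [g k]gN// dot0r.
  rewrite -si -si' !gs eon; case: eqP => // ii'.
  by move: jk; rewrite -si -si' ii' eqxx.
- move=> j; have [[i <-]|/forallNP nj] := pselect (exists i, s i = j).
    by rewrite gs (on_family_rnorm dotHE _ eon).
  by rewrite gN// rnorm0.
exists V, P; split=> // [x|[t st ts] y].
  have b1 : bounded_by (P \o V) 1 by rewrite -[1]mulr1; exact: bounded_by_comp.
  apply: (eq_on_basis (u := P \o V) (v := idfun) eb b1) => [z|i] /=.
    by rewrite mul1r.
  by rewrite VE PE /= gs.
have b1 : bounded_by (V \o P) 1 by rewrite -[1]mulr1; exact: bounded_by_comp.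
apply: (eq_on_basis (u := V \o P) (v := idfun) fb b1) => [z|j] /=.
  by rewrite mul1r.
by rewrite PE -{1}(ts j) gs VE /= ts.
Qed.

End dense_families.

(** * Completely bounded maps *)

Section matrix_norms.
Context (R : realType).

Lemma l2norm_ge0 (H : normedModType R[i]) n (h : 'cV[H]_n) : 0 <= l2norm h.
Proof. exact: sqrtr_ge0. Qed.

Lemma l2norm_entry (H : normedModType R[i]) n (h : 'cV[H]_n) i :
  rnorm (h i 0) <= l2norm h.
Proof.
rewrite -(@ler_pXn2r _ 2) ?nnegrE ?rnorm_ge0 ?l2norm_ge0//.
rewrite sqr_sqrtr ?sumr_ge0// => [|j _]; last exact: sqr_ge0.
by rewrite (bigD1 i)//= lerDl sumr_ge0// => j _; apply: sqr_ge0.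
Qed.

Lemma l2norm_le_sum (H : normedModType R[i]) n (h : 'cV[H]_n) :
  l2norm h <= \sum_(i < n) rnorm (h i 0).
Proof.
have S0 : 0 <= \sum_(i < n) rnorm (h i 0) by apply: sumr_ge0 => i _; apply: rnorm_ge0.
rewrite -(@ler_pXn2r _ 2) ?nnegrE ?l2norm_ge0//.
rewrite sqr_sqrtr ?sumr_ge0// => [|i _]; last exact: sqr_ge0.
rewrite [leRHS]expr2 mulr_sumr; apply: ler_sum => i _.
rewrite expr2 ler_wpM2r ?rnorm_ge0// (bigD1 i)//= lerDl.
by apply: sumr_ge0 => j _; apply: rnorm_ge0.
Qed.

Lemma l2norm0 (H : normedModType R[i]) n : l2norm (0 : 'cV[H]_n) = 0.
Proof.
by rewrite /l2norm big1 ?sqrtr0// => i _; rewrite mxE rnorm0 expr0n.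
Qed.

(** A predicate, because it serves both operator spaces and [c0 Y], which is equipped with matrix
    norms only. *)
Definition mnorm_homogeneous (Z : matrixNormedType R) :=
  forall n (t : R) (z : 'M[Z]_n), 0 < t ->
  mnorm (map_mx (fun y => t%:C%C *: y) z) <= t * mnorm z.

Section operator_space.
Context (X : opSpaceType R).

Lemma mnorm_ge0 n (x : 'M[X]_n) : 0 <= mnorm x.
Proof.
have [H [J [_ _ _ JE]]] := @mnorm_concrete R X.
rewrite -lee_fin JE;
apply: (@le_trans _ _ (l2norm (\col_i \sum_(j < n) J (x i j) 0))%:E).
  by rewrite lee_fin l2norm_ge0.
apply: ereal_sup_ubound; exists 0; rewrite /= ?l2norm0 ?ler01//.
congr (_%:E); congr l2norm; apply/matrixP => i j; rewrite !mxE.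
by apply: eq_bigr => k _; rewrite mxE.
Qed.

Lemma mnorm_opSpace_homogeneous : mnorm_homogeneous X.
Proof.
move=> n t x t0; have [H [J [_ _ Jl JE]]] := @mnorm_concrete R X.
rewrite -lee_fin JE; apply: ge_ereal_sup => _ [h h1 <-].
have JZ a z k : J (a *: z) k = a *: J z k.
  have J0 : J 0 k = 0.
    by have := Jl k (-1) 0 0; rewrite !scaleN1r !addNr.
  by have := Jl k a z 0; rewrite J0 !addr0.
have -> : l2norm (\col_i \sum_(j < n) J (map_mx (fun y => t%:C%C *: y) x i j) (h j 0)) =
    t * l2norm (\col_i \sum_(j < n) J (x i j) (h j 0)).
  rewrite -[t in RHS]ger0_norm ?(ltW t0)// -sqrtr_sqr /l2norm -sqrtrM ?sqr_ge0//.
  congr (Num.sqrt _); rewrite mulr_sumr; apply: eq_bigr => i _.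
  rewrite !mxE -exprMn -[t in RHS]ger0_norm ?(ltW t0)// -rnormZR scaler_sumr.
  by congr (rnorm _ ^+ 2); apply: eq_bigr => j _; rewrite mxE JZ.
rewrite lee_fin ler_pM2l// -lee_fin JE.
by apply: ereal_sup_ubound; exists h.
Qed.

(** This makes the supremum in [c0_mnorm] one over a bounded set. In the concrete representation
    each entry acts with norm at most its own norm. *)
Lemma mnorm_le_sum n (x : 'M[X]_n) : mnorm x <= \sum_(i < n) \sum_(j < n) rnorm (x i j).
Proof.
have [H [J [_ _ _ JE]]] := @mnorm_concrete R X.
have Jle y k : rnorm k <= 1 -> rnorm (J y k) <= rnorm y.
  move=> k1; rewrite -mnorm1 -lee_fin JE.
  have l2E (z : 'cV[H]_1) : l2norm z = rnorm (z 0 0).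
    by rewrite /l2norm big_ord1 sqrtr_sqr ger0_norm ?rnorm_ge0.
  apply: ereal_sup_ubound; exists (const_mx k); first by rewrite /= l2E mxE.
  by rewrite l2E !mxE big_ord1 !mxE.
rewrite -lee_fin JE; apply: ge_ereal_sup => _ [h h1 <-].
rewrite lee_fin; apply: le_trans (l2norm_le_sum _) _; apply: ler_sum => i _.
rewrite mxE; apply: le_trans (rnorm_sum _ _) _; apply: ler_sum => j _.
by apply: Jle; apply: le_trans (l2norm_entry _ _) h1.
Qed.

End operator_space.

Lemma c0_mnorm_bounded (Y : opSpaceType R) n (x : 'M[c0 Y]_n) :
  has_sup (range (fun k : nat => mnorm (\matrix_(i, j) (x i j : nat -> Y) k))).
Proof.
split; first by exists (mnorm (\matrix_(i, j) (x i j : nat -> Y) 0%N)), 0%N.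
have bnd (y : c0 Y) : exists M, forall k, rnorm ((y : nat -> Y) k) <= M.
  case: y => y /= /asboolP /= yc.
  have /cvg_seq_bounded [M [_ MP]] : cvg ((fun k => rnorm (y k)) @ \oo).
    by apply/cvg_ex; exists 0.
  have M1 : M < M + 1 by rewrite ltrDl.
  by exists (M + 1) => k; apply: le_trans (ler_norm _) (MP _ M1 k I).
have /choice[M MP] := fun p : 'I_n * 'I_n => bnd (x p.1 p.2).
exists (\sum_(i < n) \sum_(j < n) M (i, j)) => _ [k _ <-].
apply: le_trans (mnorm_le_sum _) _.
by apply: ler_sum => i _; apply: ler_sum => j _; rewrite mxE; apply: (MP (i, j)).
Qed.

Lemma c0_mnorm_coord (Y : opSpaceType R) n (x : 'M[c0 Y]_n) k :
  mnorm (\matrix_(i, j) (x i j : nat -> Y) k) <= mnorm x.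
Proof.
by apply: ub_le_sup; [exact: (c0_mnorm_bounded x).2|exists k].
Qed.

Lemma c0_mnorm_le (Y : opSpaceType R) n (x : 'M[c0 Y]_n) t :
  (forall k, mnorm (\matrix_(i, j) (x i j : nat -> Y) k) <= t) -> mnorm x <= t.
Proof.
move=> xt; apply: ge_sup; first exact: (c0_mnorm_bounded x).1.
by move=> _ [k _ <-].
Qed.

Lemma c0_mnorm_homogeneous (Y : opSpaceType R) : mnorm_homogeneous (c0 Y).
Proof.
move=> n t x t0; apply: c0_mnorm_le => k.
apply: le_trans (_ : t * mnorm (\matrix_(i, j) (x i j : nat -> Y) k) <= _); last first.
  by rewrite ler_pM2l// c0_mnorm_coord.
apply: le_trans (mnorm_opSpace_homogeneous _ t0).
by rewrite le_eqVlt; apply/orP; left; apply/eqP; congr mnorm;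
  apply/matrixP => i j; rewrite !mxE.
Qed.

Definition cb_by (X Z : matrixNormedType R) (A : set X) (u : X -> Z) (M : R) :=
  forall n (x : 'M[X]_n), (forall i j, A (x i j)) ->
  mnorm (map_mx u x) <= M * mnorm x.

(** The matrix is rescaled into the unit ball by [t] slightly above [mnorm x], so that no division
    by a zero norm occurs. Real homogeneity of [u] is asked on [A] only, since [u] may be an inverse
    defined on a range. *)
Lemma cbnorm_on_cb_by (X Z : matrixNormedType R) (A : set X) (u : X -> Z) (M : R) :
  mnorm_homogeneous X -> mnorm_homogeneous Z ->
  (forall n (x : 'M[X]_n), 0 <= mnorm x) ->
  (forall (t : R) x, A x -> A (t%:C%C *: x)) ->
  (forall (t : R) x, A x -> u (t%:C%C *: x) = t%:C%C *: u x) ->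
  0 <= M -> (cbnorm_on A u <= M%:E)%E -> cb_by A u M.
Proof.
move=> hX hZ X0 AZ uZ M0 uM n x Ax.
suff h (t : R) : 0 < t -> mnorm x <= t -> mnorm (map_mx u x) <= M * t.
  apply/ler_addgt0Pr => r r0; have r1 : 0 < r / (M + 1) by rewrite divr_gt0//; lra.
  apply: le_trans (h (mnorm x + r / (M + 1)) _ _) _; [|by lra|].
    by have := X0 n x; lra.
  rewrite mulrDr lerD2l mulrCA ger_pMr// ler_pdivrMr; lra.
move=> t0 xt; set y := map_mx (fun z => t^-1%:C%C *: z) x.
have xE : map_mx u x = map_mx (fun z => t%:C%C *: z) (map_mx u y).
  apply/matrixP => i j; rewrite !mxE uZ// scalerA -rmorphM/= divff ?gt_eqF//.
  by rewrite scale1r.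
rewrite xE; apply: le_trans (hZ _ _ _ t0) _; rewrite mulrC ler_pM2r//.
rewrite -lee_fin; apply: le_trans uM; apply: ereal_sup_ubound.
exists n, y; split=> //; first by move=> i j; rewrite mxE; apply: AZ.
apply: le_trans (hX _ _ _ _) _; first by rewrite invr_gt0.
by rewrite ler_pdivrMl// mulr1.
Qed.

Lemma cb_by_cbnorm_on (X Z : matrixNormedType R) (A : set X) (u : X -> Z) (M : R) :
  0 <= M -> cb_by A u M -> (cbnorm_on A u < +oo)%E.
Proof.
move=> M0 uM; apply: le_lt_trans (ltry M); apply: ge_ereal_sup => _ [n [x [Ax x1 ->]]].
by rewrite lee_fin; apply: le_trans (uM n x Ax) _; rewrite ler_piMr.
Qed.

Lemma cbnorm_on_fin (X Z : matrixNormedType R) (A : set X) (u : X -> Z) :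
  (cbnorm_on A u < +oo)%E -> exists2 M : R, 0 <= M & (cbnorm_on A u <= M%:E)%E.
Proof.
case: (cbnorm_on A u) => [r _|//|_]; last by exists 0; rewrite ?leNye.
by exists `|r|; rewrite ?lee_fin ?ler_norm.
Qed.

Lemma cb_by_rnorm (X Y : opSpaceType R) (u : X -> Y) (M : R) :
  cb_by setT u M -> bounded_by u M.
Proof.
move=> uM x; have := uM 1%N (const_mx x) (fun _ _ => I).
by rewrite map_const_mx !mnorm1.
Qed.

Lemma homogeneous_cb_by (X : opSpaceType R) : homogeneous X ->
  exists2 lambda : R, 0 <= lambda & forall (u : {linear X -> X}) (M : R),
    0 <= M -> bounded_by u M -> cb_by setT u (lambda * M).
Proof.
move=> [lambda l1 hl]; exists lambda => [|u M M0 uM]; first by lra.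
have uo := opnorm_bounded_by M0 uM.
have /hl ul : (opnorm u < +oo)%E by apply: le_lt_trans uo (ltry M).
apply: cbnorm_on_cb_by => //; try exact: mnorm_opSpace_homogeneous.
- by move=> n x; apply: mnorm_ge0.
- by move=> t x _; rewrite linearZ.
- by rewrite mulr_ge0//; lra.
- by apply: le_trans ul _; rewrite EFinM lee_wpmul2l// lee_fin; lra.
Qed.

(** The supremum norm of [c0 Y] splits the embedding into coordinates: [C] bounds each of them
    completely, [D] comes from the inverse, and membership in [c0] gives the pointwise decay. *)
Lemma embeds_c0_coordinates (X Y : opSpaceType R) : completely_embeds X (c0 Y) ->
  exists (U : nat -> {linear X -> Y}) (C D : R), [/\ 0 <= C, 0 <= D,
    forall n, cb_by setT (U n) C,
    forall k (x : 'M[X]_k) (t : R), (forall n, mnorm (map_mx (U n) x) <= t) ->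
      mnorm x <= D * t &
    forall x (r : R), 0 < r -> exists N, forall n, (N <= n)%N -> rnorm (U n x) < r].
Proof.
move=> [u [u_inj /cbnorm_on_fin[C C0 uC] [v [uK /cbnorm_on_fin[D D0 vD]]]]].
have /choice[U UE] n : exists g : {linear X -> Y}, g =1 (fun x => (u x : nat -> Y) n).
  by apply: linearP_pack => a x y; rewrite linearP.
have homc := @c0_mnorm_homogeneous Y.
have homx := @mnorm_opSpace_homogeneous X.
have {}uC : cb_by setT u C.
  apply: cbnorm_on_cb_by => //; first by move=> n x; apply: mnorm_ge0.
  by move=> t x _; rewrite linearZ.
have {}vD : cb_by (range u) v D.
  apply: cbnorm_on_cb_by => //.
  - by move=> n x; apply: le_trans (c0_mnorm_coord x 0%N); apply: mnorm_ge0.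
  - by move=> t _ [x _ <-]; exists (t%:C%C *: x) => //; rewrite linearZ.
  - by move=> t _ [x _ <-]; rewrite -linearZ !uK.
have coordE n k (x : 'M[X]_k) :
    map_mx (U n) x = \matrix_(i, j) (map_mx u x i j : nat -> Y) n.
  by apply/matrixP => i j; rewrite !mxE UE.
exists U, C, D; split=> // [n k x _|k x t xt|x r r0].
- by rewrite coordE; apply: le_trans (c0_mnorm_coord _ _) (uC _ _ _).
- have xE : x = map_mx v (map_mx u x) by apply/matrixP => i j; rewrite !mxE uK.
  rewrite {1}xE; apply: le_trans (vD _ _ _) _.
    by move=> i j; rewrite mxE; exists (x i j).
  by rewrite ler_wpM2l//; apply: c0_mnorm_le => n; rewrite -coordE.
- have := valP (u x); rewrite /= => /asboolP /= /cvgrPdist_lt /(_ r r0)[N _ NP].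
  exists N => n Nn; rewrite UE; have := NP n Nn.
  by rewrite /= sub0r normrN ger0_norm ?rnorm_ge0.
Qed.

Lemma complete_embedding_cb_by (X Y : opSpaceType R) (V : {linear X -> Y}) (A B : R) :
  0 <= A -> 0 <= B -> cb_by setT V A ->
  (forall n (x : 'M[X]_n), mnorm x <= B * mnorm (map_mx V x)) ->
  complete_embedding V.
Proof.
move=> A0 B0 VA VB.
have V_inj : injective V.
  move=> x y xy; apply/eqP; rewrite -subr_eq0; apply/eqP/rnorm_eq0/le_anti.
  rewrite rnorm_ge0 andbT; have := VB 1%N (const_mx (x - y)).
  by rewrite map_const_mx linearB xy subrr !mnorm1 rnorm0 mulr0.
split=> //; first exact: cb_by_cbnorm_on VA.
pose W y := xget 0 [set x | V x = y].
have VK : cancel V W.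
  by move=> x; rewrite /W; case: xgetP => [z _ /V_inj//|/(_ x) []].
exists W; split=> //; apply: (cb_by_cbnorm_on B0) => n y yV.
have -> : y = map_mx V (map_mx W y).
  by apply/matrixP => i j; rewrite !mxE; have [x _ <-] := yV i j; rewrite VK.
suff {1}-> : map_mx W (map_mx V (map_mx W y)) = map_mx W y by [].
by apply/matrixP => i j; rewrite !mxE VK.
Qed.

End matrix_norms.

(** * Cardinalities *)

Lemma injective_card_le (T U : Type) (f : T -> U) (B : set U) :
  injective f -> (forall x, B (f x)) -> [set: T] #<= B.
Proof.
move=> f_inj fB; have /card_eqPle[_ h] : f @` setT #= [set: T].
  by apply: inj_card_eq => x y _ _; apply: f_inj.
by apply: card_le_trans h _; apply: subset_card_le => _ [x _ <-].
Qed.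

Lemma card_eq_bijective (T U : Type) : [set: T] #= [set: U] ->
  exists f : T -> U, bijective f.
Proof.
move=> /card_bijP[f [g fK gK]].
exists (fun x => val (f (SigSub (mem_set (I : setT x))))).
exists (fun y => val (g (SigSub (mem_set (I : setT y))))) => [x|y].
  rewrite (_ : SigSub _ = f (SigSub (mem_set (I : setT x)))) ?fK//.
  exact: val_inj.
rewrite (_ : SigSub _ = g (SigSub (mem_set (I : setT y)))) ?gK//.
exact: val_inj.
Qed.

(** * Factorization through one coordinate *)

Section factorization.
Context (R : realType) (H K : completeNormedModType R[i]).
Context (dotH : {dot H for (Num.conj : R[i] -> R[i])}).
Context (dotHE : forall x : H, `|x| ^+ 2 = dotH x x).
Context (dotK : {dot K for (Num.conj : R[i] -> R[i])}).
Context (dotKE : forall x : K, `|x| ^+ 2 = dotK x x).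
Context (S : {linear H -> K}).
Context (c : R) (c0 : 0 < c).
Context (orth_images : forall N, exists a : nat -> H,
  [/\ forall i j, (i < N)%N -> (j < N)%N -> dotH (a i) (a j) = (i == j)%:R,
      forall i j, (i < N)%N -> (j < N)%N -> i != j ->
        dotK (S (a i)) (S (a j)) = 0 &
      forall i, (i < N)%N -> c <= rnorm (S (a i))]).

(* On the span of the a_i the identity is Q S W, where W sends a_i to b_i and
   Q sends the orthogonal vectors S b_i back to a_i. *)
Lemma factor_through_coordinate (s : seq H) :
  exists (W : {linear H -> H}) (Q : {linear K -> H}),
  [/\ bounded_by W 1, bounded_by Q c^-1 &
      forall z, z \in s -> Q (S (W z)) = z].
Proof.
have [N [a [aon sa]]] := gram_schmidt dotHE s.
have [b [bon borth bc]] := orth_images N.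
have rb i : (i < N)%N -> 0 < rnorm (S (b i)) by move=> /bc; apply: lt_le_trans.
have [|||W [W1 WE]] := finite_rank_bound dotHE dotHE (b := b) (M := 1) aon.
- by move=> i j iN jN ij; rewrite bon// (negPf ij).
- by move=> i iN; rewrite (rnorm_unit dotHE)// bon// eqxx.
- exact: ler01.
(* [Q] expands along the normalised images [f i]: [S (b i)] has coefficient [|S (b i)|], which the
   factor in [g i] cancels. That factor is at most [1 / c], the bound for [Q]. *)
pose f i := (rnorm (S (b i)))^-1%:C%C *: S (b i).
pose g i := (rnorm (S (b i)))^-1%:C%C *: a i.
have fon i j : (i < N)%N -> (j < N)%N -> dotK (f i) (f j) = (i == j)%:R.
  move=> iN jN; have [<-|ij] := eqVneq i j; last by rewrite dotZl dotZr borth// !mulr0.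
  rewrite (dot_rnorm dotKE) rnormZR ger0_norm ?invr_ge0 ?rnorm_ge0//.
  by rewrite mulVf ?expr1n// gt_eqF// rb.
have [|||Q [Q1 QE]] := finite_rank_bound dotKE dotHE (b := g) (M := c^-1) fon.
- by move=> i j iN jN ij; rewrite dotZl dotZr aon// (negPf ij) !mulr0.
- move=> i iN; rewrite rnormZR ger0_norm ?invr_ge0 ?rnorm_ge0//.
  rewrite (rnorm_unit dotHE) ?aon ?eqxx// mulr1.
  by rewrite lef_pV2 ?posrE ?rb// bc.
- by rewrite invr_ge0 ltW.
exists W, Q; split=> // z /sa {2}->.
have TZ d x : S (d *: x) = d *: S x by exact: linearZ_LR.
rewrite QE WE linear_sum; apply: eq_bigr => j _.
rewrite dot_suml (bigD1 j)//= big1 ?addr0 => [|i ij].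
  rewrite TZ dotZl dotZr conjR (dot_rnorm dotKE) -rmorphM/= scalerA -mulrA.
  rewrite -rmorphM/= expr2 mulKf ?gt_eqF ?rb// divff ?gt_eqF ?rb//.
  by rewrite mulr1.
by rewrite TZ dotZl dotZr borth ?mulr0.
Qed.

End factorization.

(** * Complete bounds for the Hilbert space embedding *)

Section embedding.
Context (R : realType) (X Y : opSpaceType R) (H K : completeNormedModType R[i]).
Context (dotH : {dot H for (Num.conj : R[i] -> R[i])}).
Context (dotHE : forall x : H, `|x| ^+ 2 = dotH x x).
Context (dotK : {dot K for (Num.conj : R[i] -> R[i])}).
Context (dotKE : forall x : K, `|x| ^+ 2 = dotK x x).
Context (uX : {linear X -> H}) (vX : {linear H -> X}).
Context (uY : {linear Y -> K}) (vY : {linear K -> Y}).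
Context (uXK : cancel uX vX) (vYK : cancel vY uY).
Context (ax bx ay b_y : R).
Context (ax0 : 0 <= ax) (bx0 : 0 <= bx) (ay0 : 0 <= ay) (by0 : 0 <= b_y).
Context (uXb : bounded_by uX ax) (vXb : bounded_by vX bx).
Context (uYb : bounded_by uY ay) (vYb : bounded_by vY b_y).
Context (homX : homogeneous X) (homY : homogeneous Y).
Context (U : nat -> {linear X -> Y}) (C D : R) (C0 : 0 <= C) (D0 : 0 <= D).
Context (UC : forall n, cb_by setT (U n) C).
Context (UD : forall k (x : 'M[X]_k) (t : R),
  (forall n, mnorm (map_mx (U n) x) <= t) -> mnorm x <= D * t).

Context (n : nat).
Context (c : R) (c0 : 0 < c).
Context (orth_images : forall N, exists a : nat -> H,
  [/\ forall i j, (i < N)%N -> (j < N)%N -> dotH (a i) (a j) = (i == j)%:R,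
      forall i j, (i < N)%N -> (j < N)%N -> i != j ->
        dotK (uY (U n (vX (a i)))) (uY (U n (vX (a j)))) = 0 &
      forall i, (i < N)%N -> c <= rnorm (uY (U n (vX (a i))))]).
Context (V : {linear H -> K}) (P : {linear K -> H}).
Context (V1 : bounded_by V 1) (P1 : bounded_by P 1) (VK : cancel V P).

Lemma hilbert_embedding_complete :
  complete_embedding (vY \o V \o uX : {linear X -> Y}).
Proof.
have [lX lX0 hX] := homogeneous_cb_by homX.
have [lY lY0 hY] := homogeneous_cb_by homY.
have Ub m : bounded_by (U m) C by apply: cb_by_rnorm.
(* Norm bounds for the maps [W'] and [Q'] below. Those maps depend on the matrix, their bounds do
   not, and so homogeneity gives one complete bound for all matrices. *)
pose MW := bx * (1 * ax); pose MQ := b_y * (1 * (c^-1 * ay)).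
have MW0 : 0 <= MW by rewrite !mulr_ge0.
have MQ0 : 0 <= MQ by rewrite !mulr_ge0// invr_ge0 ltW.
pose MP := C * (bx * (1 * ay)).
have MP0 : 0 <= MP by rewrite !mulr_ge0.
apply: (@complete_embedding_cb_by _ _ _ _ (lY * MQ * (C * (lX * MW))) (D * (lY * MP))).
- by apply: mulr_ge0; apply: mulr_ge0 => //; apply: mulr_ge0.
- by apply: mulr_ge0 => //; apply: mulr_ge0.
- move=> k x _.
  (* Only the finitely many entries of [x] have to be reproduced by the factorization. *)
  have [W [Q [W1 Q1 QW]]] :=
    factor_through_coordinate dotHE dotKE (S := uY \o U n \o vX) c0 orth_images
      [seq uX (x i j) | i <- enum 'I_k, j <- enum 'I_k].
  pose W' : {linear X -> X} := vX \o W \o uX.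
  pose Q' : {linear Y -> Y} := vY \o V \o Q \o uY.
  have W'b : bounded_by W' MW.
    exact: bounded_by_comp bx0 (bounded_by_comp ler01 uXb W1) vXb.
  have Q'b : bounded_by Q' MQ.
    have ci : 0 <= c^-1 by rewrite invr_ge0 ltW.
    exact: bounded_by_comp by0
      (bounded_by_comp ler01 (bounded_by_comp ci uYb Q1) V1) vYb.
  have -> : map_mx (vY \o V \o uX) x = map_mx Q' (map_mx (U n) (map_mx W' x)).
    apply/matrixP => i j; rewrite !mxE /=; have := QW (uX (x i j)); rewrite /= => ->//.
    by apply/allpairsP; exists (i, j); rewrite !mem_enum.
  apply: le_trans (hY _ _ MQ0 Q'b _ _ (fun _ _ => I)) _.
  rewrite -(mulrA (lY * MQ)); apply: ler_wpM2l; first exact: mulr_ge0.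
  apply: le_trans (UC _ (fun _ _ => I)) _.
  rewrite -(mulrA C); apply: ler_wpM2l => //.
  exact: (hX _ _ MW0 W'b _ _ (fun _ _ => I)).
- move=> k x; rewrite -mulrA; apply: UD => m.
  (* [W] undoes the embedding and then applies [U m]; as a bounded map of [Y] it is completely
     bounded, uniformly in [m]. *)
  pose W : {linear Y -> Y} := U m \o (vX \o P \o uY).
  have Wb : bounded_by W MP.
    exact: bounded_by_comp C0
      (bounded_by_comp bx0 (bounded_by_comp ler01 uYb P1) vXb) (Ub m).
  have -> : map_mx (U m) x = map_mx W (map_mx (vY \o V \o uX) x).
    by apply/matrixP => i j; rewrite !mxE /= vYK VK uXK.
  exact: (hY _ _ MP0 Wb _ _ (fun _ _ => I)).
Qed.

End embedding.

(** * Dimension, density character and conclusion *)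

Lemma finite_dimensional_image (R : realType) (V W : lmodType R[i])
    (u : {linear V -> W}) (v : W -> V) : cancel v u ->
  finite_dimensional V -> finite_dimensional W.
Proof.
move=> vK [n [e eV]]; exists n, (u \o e) => y.
have [a va] := eV (v y); exists a; rewrite -[LHS]vK va linear_sum.
by apply: eq_bigr => i _; rewrite linearZ_LR.
Qed.

(** [J] injects into [E], because the vectors [vY (f j)] are uniformly separated and each has a
    point of the dense set [E] close to it. [E] is equipotent with [D], and [D] is no larger than
    [I] since the points [vX (d i)] are dense in [X]. *)
Lemma density_injection (R : realType) (X Y : normedModType R[i])
    (H K : completeNormedModType R[i])
    (dotK : {dot K for (Num.conj : R[i] -> R[i])})
    (dotKE : forall x : K, `|x| ^+ 2 = dotK x x)
    (uX : {linear X -> H}) (vX : {linear H -> X}) (uXK : cancel uX vX)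
    (uY : {linear Y -> K}) (vY : {linear K -> Y}) (vYK : cancel vY uY)
    (bx ay : R) (bx0 : 0 <= bx) (ay0 : 0 <= ay)
    (vXb : bounded_by vX bx) (uYb : bounded_by uY ay)
    (I J : choiceType) (d : I -> H) (f : J -> K) :
  (forall y (r : R), 0 < r -> exists i, rnorm (y - d i) < r) ->
  on_family dotK f -> same_density X Y -> [set: J] #<= [set: I].
Proof.
move=> ddense fon [D [E [[_ Dmin] [/dense_rnorm Edense _] DE]]].
have DI : D #<= [set: I].
  apply: card_le_trans (card_image_le (vX \o d) setT); apply: Dmin.
  apply/dense_rnorm => x r r0.
  have b0 : 0 < bx + 1 by lra.
  have [|i iP] := ddense (uX x) (r / (bx + 1)); first by rewrite divr_gt0.
  exists (vX (d i)); first by exists i.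
  rewrite -{1}(uXK x) -linearB; apply: le_lt_trans (vXb _) _.
  move: iP; rewrite ltr_pdivlMr//; have := rnorm_ge0 (uX x - d i).
  by set t := rnorm _; nra.
apply: card_le_trans DI; apply: (@card_le_trans _ _ _ E); last first.
  by have /card_eqPle[] := DE.
(* Two vectors [vY (f j)] sharing a point of [E] would be within [2r], so their images under [uY]
   within [2 r ay < 1]. *)
pose r := (3 * (ay + 1))^-1.
have r0 : 0 < r by rewrite invr_gt0 mulr_gt0//; lra.
have /choice[g gP] j : exists y, E y /\ rnorm (vY (f j) - y) < r.
  by have [y Ey yr] := Edense (vY (f j)) r r0; exists y.
apply: (@injective_card_le _ _ g) => [i j gij|j]; last by case: (gP j).
apply/eqP; apply: contraT => /(on_family_dist dotKE fon) ij.
have [_ gi] := gP i; have [_ gj] := gP j.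
have := rnorm_triangle (vY (f i)) (g i) (vY (f j)).
rewrite {2}gij (rnormB (g j)) -linearB => h.
have := uYb (vY (f i - f j)); rewrite vYK => h'.
have {}h : rnorm (vY (f i - f j)) <= r * 2 by lra.
have : 1 <= ay * (r * 2) by apply: le_trans ij _; apply: le_trans h' _; rewrite ler_wpM2l.
have rE : r * (3 * (ay + 1)) = 1 by rewrite mulVf// gt_eqF// mulr_gt0//; lra.
by rewrite leNgt => /negP; case; nra.
Qed.

Theorem theorem1p6 (R : realType) (X Y : opSpaceType R)
    (homX : homogeneous X) (hilX : hilbertian X)
    (homY : homogeneous Y) (hilY : hilbertian Y)
    (infX : ~ finite_dimensional X)
    (embX : completely_embeds X (c0 Y)) :
  completely_embeds X Y /\ (same_density X Y -> completely_isomorphic X Y).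
Proof.
have [H [uX [vX [[dotH dotHE] uXK vXK]]]] := hilX.
move=> /continuous_bounded_by[ax ax0 uXb] /continuous_bounded_by[bx bx0 vXb].
have [K [uY [vY [[dotK dotKE] uYK vYK]]]] := hilY.
move=> /continuous_bounded_by[ay ay0 uYb] /continuous_bounded_by[b_y by0 vYb].
have [U [C [D [C0 D0 UC UD Ucvg]]]] := embeds_c0_coordinates embX.
have infH : ~ finite_dimensional H by move=> /(finite_dimensional_image uXK).
pose T n : {linear H -> K} := uY \o U n \o vX.
have Tb n : bounded_by (T n) (ay * (C * bx)).
  by apply: bounded_by_comp ay0 (bounded_by_comp C0 vXb (cb_by_rnorm (UC n))) uYb.
have Tcvg x (r : R) : 0 < r -> exists N, forall n, (N <= n)%N -> rnorm (T n x) < r.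
  move=> r0; have a0 : 0 < ay + 1 by lra.
  have [|N NP] := Ucvg (vX x) (r / (ay + 1)); first by rewrite divr_gt0.
  exists N => n /NP; rewrite ltr_pdivlMr//; have := uYb (U n (vX x)).
  rewrite /T /=; have := rnorm_ge0 (U n (vX x)).
  by set s := rnorm _; set t := rnorm _; nra.
(* A bound [t] on all [T n x] gives [b_y t] for the coordinates in [Y], [D b_y t] for [vX x] and
   [M t] for [x]. Using [M + 1] keeps the inverse positive when [M = 0]. *)
pose M := ax * (D * b_y).
have M0 : 0 <= M by rewrite !mulr_ge0.
have M1 : 0 < M + 1 by lra.
have Mi0 : 0 < (M + 1)^-1 by rewrite invr_gt0.
have Tlow x (t : R) : (forall n, rnorm (T n x) <= t) -> (M + 1)^-1 * rnorm x <= t.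
  move=> Tt; have t0 : 0 <= t by apply: le_trans (Tt 0%N); apply: rnorm_ge0.
  rewrite ler_pdivrMl//; apply: (@le_trans _ _ (M * t)); last by rewrite ler_wpM2r//; lra.
  rewrite -{1}(vXK x); apply: le_trans (uXb _) _; rewrite -mulrA ler_wpM2l//.
  rewrite -mnorm1 -mulrA; apply: UD => n; rewrite map_const_mx mnorm1.
  by rewrite -(uYK (U n (vX x))); apply: le_trans (vYb _) _; rewrite ler_wpM2l// Tt.
have [n [c [c0 Tn orthT]]] :=
  exists_orth_images dotHE dotK infH (mulr_ge0 ay0 (mulr_ge0 C0 bx0))
    Mi0 Tb Tcvg Tlow.
have [I [e eb]] := exists_on_basis dotHE.
have [J [f fb]] := exists_on_basis dotKE.
have Jinf := infinite_basis dotKE Tn fb.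
have Iinf : infinite_set [set: I].
  apply: (infinite_basis dotHE (u := idfun) _ eb) => S Sf.
  exact: fincodim_neq0.
have [d ddense] := dense_of_basis dotKE Jinf fb.
have [g g_inj] := basis_injection dotHE eb.1 ddense Mi0 Tcvg Tlow.
have [sJ sJ_inj] := seq_injection Jinf.
have embed (V : {linear H -> K}) (P : {linear K -> H}) (V1 : bounded_by V 1)
    (P1 : bounded_by P 1) (VK : cancel V P) :=
  hilbert_embedding_complete dotHE dotKE uXK vYK ax0 bx0 ay0 by0 uXb vXb uYb vYb
    homX homY C0 D0 UC UD c0 orthT V1 P1 VK.
(* Each basis index of [H] gives a finite sequence of basis indices of [K], which is coded by a
   single one. *)
have s_inj : injective (sJ \o g) := inj_comp sJ_inj g_inj.
split.
  have [V [P [V1 P1 VK _]]] := basis_embedding dotKE dotHE eb fb s_inj.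
  exists (vY \o V \o uX); exact: (embed V P).
(* Equal density characters give the reverse comparison of the bases, hence a bijection, for which
   [P] is a two-sided inverse of [V]. *)
move=> XY; have [dI dIdense] := dense_of_basis dotHE Iinf eb.
have JI := density_injection dotKE uXK vYK bx0 ay0 vXb uYb dIdense fb.1 XY.
have IJ : [set: I] #<= [set: J] by apply: injective_card_le s_inj _.
have [s s_bij] := card_eq_bijective (Cantor_Bernstein IJ JI).
have [V [P [V1 P1 VK PK]]] := basis_embedding dotKE dotHE eb fb (bij_inj s_bij).
exists (vY \o V \o uX); split; first exact: (embed V P).
apply/seteqP; split=> // y _; exists (vX (P (uY y))) => //=.
by rewrite vXK PK// uYK.
Qed.
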